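(* Let $\mathcal{N}=\mathcal{N}(P,E)$ be a ported unimodular oriented matroid. Then $\mathbf{M}_E(\mathcal{N})$ equals the element of the exterior algebra obtained from the polynomial $R(\mathcal{N}(P,E))$ by substituting $u=0$, $v=0$ and, in each term, replacing the monomial $[\mathcal{N}/A|P]$ by the extensor $\epsilon(P)\,\epsilon(PE)\,\mathbf{M}_\emptyset(\mathbf{L}_A)$, where $\mathbf{L}_A$ is a unimodular extensor with ground set $P$ presenting the oriented matroid $\mathcal{N}/A|P$ (the result does not depend on the sign choice $\pm\mathbf{L}_A$).
   Context: $K\subseteq\mathbb{R}$ is a field, extended by parameters $g_e,r_e$ ($e\in E$); $g_A=\prod_{e\in A}g_e$. For a finite set $S$, $\mathcal{E}(KS)$ is the exterior algebra over $KS$ with basis $S$; for a sequence $A$ of distinct elements, $\mathbf{A}$ is the product of their images in order. Set symbols denote sequences in an arbitrary order; $AB$ is concatenation; $\bar X$ is the complement in the ground set. An extensor with ground set $S$ is an element of $\mathcal{E}(KS)$ that is a scalar multiple of $\mathbf{1}$ or an exterior product of vectors; its Plücker coordinates are the alternating function $\mathbf{N}[A]$ with $\mathbf{N}=\sum_A\mathbf{N}[A]\mathbf{A}$. A nonzero extensor presents the oriented matroid on $S$ whose chirotope is $B\mapsto\mathrm{sign}\,\mathbf{N}[B]$; it is unimodular if all its Plücker coordinates lie in $\{0,\pm1\}$; every unimodular (regular) oriented matroid is presented by exactly two unimodular extensors $\pm\mathbf{N}$. Contraction: $(\mathbf{N}/e)[B]=\mathbf{N}[Be]$, $\mathbf{N}/X=\mathbf{N}/x_k/\cdots/x_1$.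 A ground set orientation $\epsilon$ is an alternating function on finite sequences of ground set elements into $\{1,-1,0\}$, nonzero on sequences of distinct elements, $\epsilon(\emptyset)=1$; canonical dual $\mathbf{N}^\perp[X]=\mathbf{N}[\bar X]\epsilon(\bar X X)$. A ported extensor $\mathbf{N}(P,E)$ has ground set $P\sqcup E$; $P_\iota,P_\upsilon$ are disjoint copies of $P$; $\iota_g,\upsilon_r$ are the algebra homomorphisms induced by $\mathbf{e}\mapsto g_e\mathbf{e},\ \mathbf{p}\mapsto\mathbf{p}_\iota$ and $\mathbf{e}\mapsto r_e\mathbf{e},\ \mathbf{p}\mapsto\mathbf{p}_\upsilon$; $\mathbf{M}(\mathbf{N})=\iota_g(\mathbf{N})\upsilon_r(\mathbf{N}^\perp)$ and, with $E$ a fixed sequence, $\mathbf{M}_E(\mathbf{N})=\mathbf{M}(\mathbf{N})/E$. For a ported unimodular oriented matroid $\mathcal{N}(P,E)$ (an oriented matroid on $P\sqcup E$ with distinguished subset $P$ of ports), $\mathbf{M}_E(\mathcal{N}):=\mathbf{M}_E(\mathbf{N})$ where $\pm\mathbf{N}$ are its unimodular presentations. For $A\subseteq E$, $\mathcal{N}/A|P$ is the oriented minor obtained by contracting $A$ and deleting $E\setminus A$. The polynomial $R$: for every connected oriented matroid $\mathcal{Q}$ whose ground set is a nonempty subset of $P$ there is a commuting variable $[\mathcal{Q}]$ (different orientations give different variables); for an oriented matroid on $P$ with connected components $\mathcal{Q}_1,\dots,\mathcal{Q}_c$, $[\mathcal{Q}_1\oplus\cdots\oplus\mathcal{Q}_c]$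 denotes $[\mathcal{Q}_1]\cdots[\mathcal{Q}_c]$ (and $=1$ for empty ground set). With $\rho$ the rank function of $\mathcal{N}$, \[R(\mathcal{N}(P,E))=\sum_{A\subseteq E}[\mathcal{N}/A|P]\,g_A\,r_{E\setminus A}\,u^{\rho\mathcal{N}-\rho(\mathcal{N}/A|P)-\rho(A)}\,v^{|A|-\rho(A)}.\] *)

(* Defs.v *)
From HB Require Import structures.
From mathcomp Require Import all_boot all_order all_algebra generic_quotient.
From mathcomp Require Import boolp reals.
From mathcomp Require classical_sets finmap.
From mathcomp.multinomials Require Import monalg.

Set Implicit Arguments.
Unset Strict Implicit.
Unset Printing Implicit Defensive.

Import Order.TTheory GRing.Theory Num.Theory.
Local Open Scope ring_scope.
Local Open Scope quotient_scope.

Lemma setUDK (T : finType) (A B : {set T}) :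
  A \subset B -> A :|: (B :\: A) = B.
Proof. by move=> sAB; rewrite -{1}(setIidPr sAB) setID. Qed.

Section Inversions.
Variable T : finType.
Implicit Types A B C : {set T}.

(* The number of inversions between two sets, for the order of [enum T]. *)
Definition invs A B : nat :=
  \sum_(a in A) \sum_(b in B) (enum_rank b < enum_rank a)%N.

Lemma invs0s B : invs set0 B = 0%N.
Proof. by rewrite /invs big_set0. Qed.

Lemma invss0 A : invs A set0 = 0%N.
Proof. by rewrite /invs big1 // => a _; rewrite big_set0. Qed.

Lemma invsUl A B C : [disjoint A & B] ->
  invs (A :|: B) C = (invs A C + invs B C)%N.
Proof.
by move=> dAB; rewrite /invs -bigU //; apply: eq_bigl => a; rewrite inE.
Qed.

Lemma invsUr A B C : [disjoint B & C] ->
  invs A (B :|: C) = (invs A B + invs A C)%N.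
Proof.
move=> dBC; rewrite /invs -big_split; apply: eq_bigr => a _ /=.
by rewrite -bigU //; apply: eq_bigl => b; rewrite inE.
Qed.

End Inversions.

(* The element [f] stands for the sum of the [f A *: e_A], where [e_A] is the
   product of the basis vectors indexed by [A] taken in the order of [enum A]. *)
Definition exterior (R : comNzRingType) (T : finType) := {ffun {set T} -> R^o}.

Section ExteriorAlgebra.
Variables (R : comNzRingType) (T : finType).
Local Notation X := (exterior R T).
Implicit Types x y z : X.

HB.instance Definition _ := GRing.Lmodule.copy X {ffun {set T} -> R^o}.

Definition wedge x y : X :=
  [ffun C : {set T} => \sum_(A : {set T} | A \subset C)
     (-1) ^+ invs A (C :\: A) * (x A * y (C :\: A)) : R].

Definition ext1 : X := [ffun A => (A == set0)%:R].

Fact wedgeA : associative wedge.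
Proof.
move=> x y z; apply/ffunP=> C; rewrite !ffunE.
transitivity (\sum_(A : {set T} | A \subset C)
   \sum_(B : {set T} | (A \subset B) && (B \subset C))
   (-1) ^+ (invs A (C :\: A) + invs (B :\: A) (C :\: B)) *
     (x A * y (B :\: A) * z (C :\: B)) : R).
  apply: eq_bigr => A sAC; rewrite ffunE mulr_sumr mulr_sumr.
  rewrite (reindex_onto (fun B => B :\: A) (fun D => A :|: D)) /=; last first.
    move=> D; rewrite subsetD => /andP[_ dDA].
    by rewrite setDUl setDv set0U; apply/setDidPl.
  apply: eq_big => [B|B].
    apply/andP/andP=> [[s /eqP e]|[sAB sBC]]; last first.
      by split; [exact: setSD | apply/eqP/setUDK].
    have sAB : A \subset B by rewrite -e subsetUl.
    split=> //; rewrite -(setUidPr sAB) subUset sAC.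
    by rewrite -(setID B A) subUset (subset_trans (subsetIr _ _) sAC)
       (subset_trans s (subsetDl _ _)).
  case/andP=> _ /eqP e.
  have sAB : A \subset B by rewrite -e subsetUl.
  have -> : C :\: A :\: (B :\: A) = C :\: B.
    apply/setP=> t; rewrite !inE; case tA: (t \in A) => //=.
    by rewrite (subsetP sAB).
  rewrite exprD -!mulrA; congr (_ * _).
  by rewrite [in RHS]mulrCA.
rewrite (exchange_big_dep (fun B : {set T} => B \subset C)) /=; last first.
  by move=> A B _ /andP[].
apply: eq_bigr => B sBC; rewrite ffunE mulr_suml mulr_sumr.
apply: eq_big => [A|A /andP[sAC /andP[sAB _]]].
  by rewrite sBC andbT andb_idl // => sAB; apply: subset_trans sBC.
have eC : C :\: A = (B :\: A) :|: (C :\: B).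
  apply/setP=> t; rewrite !inE; case tA: (t \in A) => //=.
    by rewrite (subsetP sAB).
  by case tB: (t \in B) => //=; rewrite (subsetP sBC).
have d1 : [disjoint B :\: A & C :\: B].
  rewrite -setI_eq0; apply/eqP/setP=> t; rewrite !inE.
  by case: (t \in B); rewrite ?andbF.
have eB : B = A :|: (B :\: A) by rewrite setUDK.
have d2 : [disjoint A & B :\: A].
  by rewrite -setI_eq0; apply/eqP/setP=> t; rewrite !inE; case: (t \in A).
have -> : invs B (C :\: B) = (invs A (C :\: B) + invs (B :\: A) (C :\: B))%N.
  by rewrite {1}eB invsUl.
rewrite eC invsUr // !exprD !mulrA; congr (_ * _ * _).
by congr (_ * _); rewrite -mulrA mulrC.
Qed.

Fact wedge1x : left_id ext1 wedge.
Proof.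
move=> x; apply/ffunP=> C; rewrite ffunE (bigD1 set0) ?sub0set //= big1.
  by rewrite !ffunE eqxx setD0 invs0s mul1r mul1r addr0.
by move=> A /andP[_ nA]; rewrite ffunE (negPf nA) mul0r mulr0.
Qed.

Fact wedgex1 : right_id ext1 wedge.
Proof.
move=> x; apply/ffunP=> C; rewrite ffunE (bigD1 C) //= big1.
  by rewrite !ffunE setDv eqxx invss0 mul1r mulr1 addr0.
move=> A /andP[sAC nA]; rewrite ffunE setD_eq0.
suff /negPf-> : ~~ (C \subset A) by rewrite !mulr0.
by apply: contra nA => sCA; rewrite eqEsubset sAC.
Qed.

Fact wedgeDl : left_distributive wedge +%R.
Proof.
move=> x y z; apply/ffunP=> C; rewrite !ffunE -big_split; apply: eq_bigr => A _.
by rewrite ffunE mulrDl mulrDr.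
Qed.

Fact wedgeDr : right_distributive wedge +%R.
Proof.
move=> x y z; apply/ffunP=> C; rewrite !ffunE -big_split; apply: eq_bigr => A _.
by rewrite ffunE mulrDr mulrDr.
Qed.

Fact ext1_neq0 : ext1 != 0 :> X.
Proof.
by apply/eqP=> /ffunP /(_ set0); rewrite !ffunE eqxx => /eqP; rewrite oner_eq0.
Qed.

HB.instance Definition _ := GRing.Zmodule_isNzRing.Build X
  wedgeA wedge1x wedgex1 wedgeDl wedgeDr ext1_neq0.

Fact wedgeZl (a : R) (x y : X) : a *: (x * y) = (a *: x) * y.
Proof.
apply/ffunP=> C; rewrite !ffunE [LHS]mulr_sumr; apply: eq_bigr => A _.
by rewrite ffunE mulrCA [RHS]mulrA -!mulrA.
Qed.

HB.instance Definition _ := GRing.Lmodule_isLalgebra.Build R X wedgeZl.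

Fact wedgeZr (a : R) (x y : X) : a *: (x * y) = x * (a *: y).
Proof.
apply/ffunP=> C; rewrite !ffunE [LHS]mulr_sumr; apply: eq_bigr => A _.
by rewrite ffunE mulrCA; congr (_ * _); rewrite mulrCA.
Qed.

HB.instance Definition _ := GRing.Lalgebra_isAlgebra.Build R X wedgeZr.

Definition eset (A : {set T}) : X := [ffun B => (B == A)%:R].

Definition evec (t : T) : X := eset [set t].

Definition eseq (s : seq T) : X := \prod_(t <- s) evec t.

(* [eseq s] is plus or minus [eset [set:: s]], or 0 if [s] has repetitions. *)
Definition plucker x (s : seq T) : R := eseq s [set:: s] * x [set:: s].

Lemma esetM A B :
  eset A * eset B =
    if [disjoint A & B] then (-1) ^+ invs A B *: eset (A :|: B) else 0 :> X.
Proof.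
apply/ffunP=> C; rewrite ffunE.
transitivity (((A \subset C) && (C :\: A == B))%:R * (-1) ^+ invs A B : R).
  have [sAC|nAC] /= := boolP (A \subset C); last first.
    rewrite big1 ?mul0r // => D sDC; rewrite ffunE.
    suff /negPf-> : D != A by rewrite mul0r mulr0.
    by apply: contra nAC => /eqP<-.
  rewrite (bigD1 A) //= big1 ?addr0 => [|D /andP[_ /negPf nD]]; last first.
    by rewrite ffunE nD mul0r mulr0.
  rewrite !ffunE eqxx mul1r mulrC.
  by case: eqP => [->|]; rewrite ?mul1r ?mul0r.
have [dAB|ndAB] := boolP [disjoint A & B]; rewrite !ffunE; last first.
  have [sAC|] /= := boolP (A \subset C); last by rewrite mul0r.
  case: eqP => [e|]; rewrite ?mul0r //; case/negP: ndAB.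
  by rewrite -e -setI_eq0; apply/eqP/setP=> t; rewrite !inE; case: (t \in A).
suff -> : (A \subset C) && (C :\: A == B) = (C == A :|: B) by rewrite mulrC.
apply/andP/eqP=> [[sAC /eqP<-]|->]; first by rewrite setUDK.
split; first exact: subsetUl.
rewrite setDUl setDv set0U; apply/eqP/setDidPl.
by rewrite disjoint_sym.
Qed.

Lemma eseq_cons t s : eseq (t :: s) = evec t * eseq s.
Proof. exact: big_cons. Qed.

Lemma eseq_cat s1 s2 : eseq (s1 ++ s2) = eseq s1 * eseq s2.
Proof. exact: big_cat. Qed.

Lemma eseqE s : eseq s = eseq s [set:: s] *: eset [set:: s].
Proof.
suff [c ->] : exists c, eseq s = c *: eset [set:: s].
  by congr (_ *: _); rewrite !ffunE eqxx; apply/esym/mulr1.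
elim: s => [|t s [c IHs]].
  exists 1; rewrite scale1r /eseq big_nil; apply/ffunP=> A; rewrite !ffunE.
  by congr (_ == _)%:R; apply/setP=> t; rewrite !inE.
rewrite eseq_cons IHs -wedgeZr esetM set_cons.
by case: ifP => _; [exists (c * (-1) ^+ invs [set t] [set:: s]); rewrite scalerA
                   |exists 0; rewrite scaler0 scale0r].
Qed.

Lemma eseq_uniq s : uniq s -> exists k, eseq s = (-1) ^+ k *: eset [set:: s].
Proof.
elim: s => [_|t s IHs /= /andP[ts /IHs[k e]]].
  exists 0%N; rewrite scale1r /eseq big_nil; apply/ffunP=> A; rewrite !ffunE.
  by congr (_ == _)%:R; apply/setP=> t; rewrite !inE.
exists (k + invs [set t] [set:: s])%N.
rewrite eseq_cons e -wedgeZr esetM set_cons disjoints1 inE ts scalerA.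
by rewrite exprD.
Qed.

Lemma eseq_nuniq s : ~~ uniq s -> eseq s = 0.
Proof.
elim: s => //= t s IHs; rewrite negb_and negbK eseq_cons => /orP[ts|/IHs->];
  last by rewrite mulr0.
by rewrite eseqE -wedgeZr esetM disjoints1 inE ts scaler0.
Qed.

Lemma enum_sorted (A : {set T}) :
  sorted (fun a b : T => enum_rank a < enum_rank b)%N (enum A).
Proof.
rewrite /enum_mem -enumT; apply: sorted_filter.
  by move=> a b c; apply: ltn_trans.
case e: (enum T) => [//|t0 s0]; rewrite -e; apply/(sortedP t0) => i lti.
have H j : (j < size (enum T))%N -> enum_rank (nth t0 (enum T) j) = j :> nat.
  move=> ltj; apply/eqP; rewrite -(nth_uniq t0 _ ltj (enum_uniq T)).
    by rewrite nth_enum_rank.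
  by rewrite -cardE ltn_ord.
by rewrite !H // ltnW.
Qed.

Lemma eseq_enum (A : {set T}) : eseq (enum A) = eset A.
Proof.
suff H s : sorted (fun a b : T => enum_rank a < enum_rank b)%N s ->
    eseq s = eset [set:: s].
  by rewrite H ?enum_sorted //; congr eset; apply/setP=> t; rewrite inE mem_enum.
have tr : transitive (fun a b : T => enum_rank a < enum_rank b)%N.
  by move=> a b c; apply: ltn_trans.
elim: s => [_|t s IHs].
  rewrite /eseq big_nil; apply/ffunP=> B; rewrite !ffunE.
  by congr (_ == _)%:R; apply/setP=> t; rewrite !inE.
rewrite /sorted path_sortedE // => /andP[/allP lt_s /IHs e].
rewrite eseq_cons e esetM set_cons disjoints1 inE.
have -> : t \notin s by apply/negP=> /lt_s; rewrite ltnn.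
rewrite /invs big_set1 big1 ?scale1r // => b; rewrite inE => /lt_s.
by rewrite ltnNge leq_eqVlt negb_or => /andP[_ /negPf->].
Qed.

(* Any choice of an ordering [o A] of each set [A] gives the same expansion. *)
Lemma exteriorE x (o : {set T} -> seq T) :
    (forall A, uniq (o A) /\ [set:: o A] = A) ->
  x = \sum_A plucker x (o A) *: eseq (o A).
Proof.
move=> oP; transitivity (\sum_A x A *: eset A).
  apply/ffunP=> A; rewrite sum_ffunE (bigD1 A) //= big1 => [|B /negPf nB].
    by rewrite !ffunE eqxx addr0; apply/esym/mulr1.
  by rewrite !ffunE eq_sym nB; apply: mulr0.
apply: eq_bigr => A _; have [/eseq_uniq[k e] eA] := oP A.
rewrite /plucker e eA scalerA !ffunE eqxx; congr (_ *: _).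
rewrite [_ *: _]mulr1 mulrAC -expr2 sqrr_sign; exact/esym/mul1r.
Qed.

Lemma plucker_uniq_eq0 x s : uniq s ->
  (plucker x s == 0) = (x [set:: s] == 0).
Proof.
move=> /eseq_uniq[k e]; rewrite /plucker e !ffunE eqxx [_ *: _]mulr1.
by rewrite -signr_odd; case: odd; rewrite ?mul1r ?mulN1r ?oppr_eq0.
Qed.

End ExteriorAlgebra.

Section OrientedMatroids.
Variable T : finType.
Implicit Types (S A B D X Y Z : {set T}) (c : exterior int T) (s t : seq T).

(* An alternating function on sequences is encoded by the element of the
   exterior algebra over the integers of which it is the [plucker] function.
   The last condition is the sign form of the Grassmann-Pluecker relations;
   it is trivial for sequences whose length is not the rank. *)
Definition is_chirotope S c : Prop :=
  [/\ exists B, c B != 0,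
      forall B, c B \in [:: 0; 1; -1],
      forall B, c B != 0 -> B \subset S,
      forall A B, c A != 0 -> c B != 0 -> #|A| = #|B| &
      forall x s t,
        (forall i, (i < size t)%N ->
           0 <= plucker c (nth x t i :: s) * plucker c (set_nth x t i x)) ->
        0 <= plucker c (x :: s) * plucker c t].

Definition chirotope := {Sc : {set T} * exterior int T | `[< is_chirotope Sc.1 Sc.2 >]}.

Implicit Types C : chirotope.
Definition chi C : exterior int T := (val C).2.
Definition gset C : {set T} := (val C).1.

Lemma chiP C : is_chirotope (gset C) (chi C).
Proof. exact/asboolP/(valP C). Qed.

Definition chir_equiv : rel chirotope := fun C1 C2 =>
  (gset C1 == gset C2) && ((chi C1 == chi C2) || (chi C1 == - chi C2)).

Fact chir_equiv_refl : reflexive chir_equiv.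
Proof. by move=> C; rewrite /chir_equiv !eqxx. Qed.

Fact chir_equiv_sym : symmetric chir_equiv.
Proof.
move=> C1 C2; rewrite /chir_equiv eq_sym [chi C1 == chi C2]eq_sym.
by rewrite [chi C1 == - _]eq_sym eqr_oppLR.
Qed.

Fact chir_equiv_trans : transitive chir_equiv.
Proof.
move=> C2 C1 C3 /andP[/eqP e1 /orP h1] /andP[/eqP e2 /orP h2].
rewrite /chir_equiv e1 e2 eqxx /=.
by case: h1 => /eqP->; case: h2 => /eqP->; rewrite ?opprK eqxx ?orbT.
Qed.

Canonical chir_equiv_rel :=
  EquivRel chir_equiv chir_equiv_refl chir_equiv_sym chir_equiv_trans.

(* An oriented matroid is a pair {chi, - chi} of chirotopes. *)
Definition om := {eq_quot chir_equiv_rel}.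
HB.instance Definition _ := Choice.on om.
HB.instance Definition _ := EqQuotient.on om.

Definition ground (M : om) : {set T} := gset (repr M).

Lemma repr_pi C : chir_equiv (repr (\pi_om C)) C.
Proof. by have /eqmodP := reprK (\pi_om C). Qed.

Lemma ground_pi C : ground (\pi_om C) = gset C.
Proof. by case/andP: (repr_pi C) => /eqP. Qed.

Lemma chi_pi0 C B : (chi (repr (\pi_om C)) B == 0) = (chi C B == 0).
Proof.
by case/andP: (repr_pi C) => _ /orP[] /eqP->; rewrite // !ffunE oppr_eq0.
Qed.

Definition basis (M : om) B := chi (repr M) B != 0.

Lemma ex_basis (M : om) : exists B, basis M B.
Proof. by have [h _ _ _ _] := chiP (repr M). Qed.

Definition rank (M : om) A : nat := \max_(B : {set T} | basis M B) #|B :&: A|.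

(* The alternating function s |-> c (s Z) on sequences in [S]. *)
Definition slice c S Z : exterior int T :=
  [ffun B : {set T} => if B \subset S then plucker c (enum B ++ enum Z) else 0].

Lemma set_seqE s S : ([set:: s] \subset S) = all (mem S) s.
Proof.
apply/subsetP/allP=> h x; first by move=> xs; apply: h; rewrite inE.
by rewrite inE; apply: h.
Qed.

Lemma set_enum_cat s t : [set:: enum [set:: s] ++ t] = [set:: s ++ t].
Proof. by apply/setP=> x; rewrite !inE !mem_cat mem_enum inE. Qed.

Lemma plucker_slice c S Z s :
  plucker (slice c S Z) s = if all (mem S) s then plucker c (s ++ enum Z) else 0.
Proof.
rewrite {1}/plucker ffunE set_seqE; case: ifP => _; last exact: mulr0.
rewrite /plucker set_enum_cat !eseq_cat mulrA; congr (_ * _).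
by rewrite eseq_enum [in RHS]eseqE -wedgeZl [in RHS]ffunE.
Qed.

Lemma plucker_eq0 c s : plucker c s != 0 -> uniq s /\ c [set:: s] != 0.
Proof.
move=> n0; suff us : uniq s by rewrite -plucker_uniq_eq0.
by apply: contraR n0 => nu; rewrite /plucker eseq_nuniq // ffunE mul0r.
Qed.

Lemma plucker_val c s : (forall B, c B \in [:: 0; 1; -1]) ->
  plucker c s \in [:: 0; 1; -1].
Proof.
move=> h; have [us|nu] := boolP (uniq s); last first.
  by rewrite /plucker eseq_nuniq // ffunE mul0r.
have [k e] := eseq_uniq int us; rewrite /plucker e !ffunE eqxx [_ *: _]mulr1.
rewrite -signr_odd; case: odd; last by rewrite mul1r.
rewrite mulN1r; move: (h [set:: s]); rewrite !inE.
by case/or3P=> /eqP->; rewrite ?oppr0 ?opprK ?eqxx ?orbT.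
Qed.

Lemma slice_neq0 c S Z B : slice c S Z B != 0 ->
  [/\ B \subset S, [disjoint B & Z] & c (B :|: Z) != 0].
Proof.
rewrite ffunE; case: ifP => // sBS /plucker_eq0[].
rewrite cat_uniq !enum_uniq /= andbT => /hasPn h.
have -> : [set:: enum B ++ enum Z] = B :|: Z.
  by apply/setP=> x; rewrite !inE mem_cat !mem_enum.
split=> //; rewrite disjoint_sym disjoint_subset; apply/subsetP=> x xZ.
by rewrite inE; have := h x; rewrite !mem_enum; apply.
Qed.

Lemma slice_neq0I c S Z B : B \subset S -> [disjoint B & Z] ->
  c (B :|: Z) != 0 -> slice c S Z B != 0.
Proof.
move=> sBS dBZ n0; rewrite ffunE sBS plucker_uniq_eq0.
  have -> // : [set:: enum B ++ enum Z] = B :|: Z.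
  by apply/setP=> x; rewrite !inE mem_cat !mem_enum.
rewrite cat_uniq !enum_uniq /= andbT; apply/hasPn=> x; rewrite !mem_enum => xZ.
by apply: contraL dBZ => xB; apply/pred0Pn; exists x; rewrite /= xB.
Qed.

Lemma slice_chirotope S c S' Z B : is_chirotope S c ->
  c B != 0 -> Z \subset B -> B :\: Z \subset S' -> is_chirotope S' (slice c S' Z).
Proof.
move=> [_ h1 h2 h3 h4] nB sZB sBS; split.
- exists (B :\: Z); apply: slice_neq0I => //.
    by rewrite -setI_eq0; apply/eqP/setP=> x; rewrite !inE; case: (x \in Z); rewrite ?andbF.
  by rewrite setUC setUDK.
- by move=> D; rewrite ffunE; case: ifP => // _; apply: plucker_val.
- by move=> D /slice_neq0[].
- move=> A D /slice_neq0[_ dA nA] /slice_neq0[_ dD nD].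
  have cU (F : {set T}) : [disjoint F & Z] -> #|F :|: Z| = (#|F| + #|Z|)%N.
    by move=> dF; rewrite -cardsUI disjoint_setI0 // cards0 addn0.
  by apply: (@addIn #|Z|); rewrite -!cU //; apply: h3.
move=> x s t; rewrite !plucker_slice.
have [aS|] := boolP (all (mem S') (x :: s)); last by rewrite mul0r.
have [at_|] := boolP (all (mem S') t); last by rewrite mulr0.
move=> h; rewrite cat_cons; apply: h4 => i; rewrite size_cat => lti.
have [ltit|leti] := ltnP i (size t).
  have [xS sS] : x \in S' /\ all (mem S') s by apply/andP.
  have a1 : all (mem S') (nth x t i :: s).
    by rewrite /= sS andbT; apply: (allP at_); rewrite mem_nth.
  have a2 : all (mem S') (set_nth x t i x).
    rewrite set_nthE ltit all_cat /= xS.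
    by move: at_; rewrite -{1}(cat_take_drop i t) all_cat (drop_nth x ltit) /=
      => /andP[-> /andP[_ ->]].
  have e : set_nth x (t ++ enum Z) i x = set_nth x t i x ++ enum Z.
    rewrite !set_nthE size_cat ltit ltn_addr // take_cat drop_cat ltit -catA.
    congr (_ ++ _ :: _); case: ltnP => // le.
    rewrite (_ : i.+1 - size t = 0)%N ?drop0 ?drop_oversize //.
    by apply/eqP; rewrite subn_eq0.
  by have := h i ltit; rewrite !plucker_slice a1 a2 e nth_cat ltit.
rewrite nth_cat ltnNge leti /=.
suff -> : plucker c (nth x (enum Z) (i - size t) :: s ++ enum Z) = 0.
  by rewrite mul0r.
rewrite /plucker eseq_nuniq ?ffunE ?mul0r //= mem_cat mem_nth ?orbT //.
by rewrite ltn_subLR.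
Qed.

Lemma basis_exchange M A B x : basis M A -> basis M B -> x \in A -> x \notin B ->
  exists2 y, y \in B :\: A & basis M (x |: B :\ y).
Proof.
rewrite /basis; set c := chi _ => bA bB xA xB.
have [_ _ _ h3 h4] := chiP (repr M); rewrite -/c in h3 h4.
apply: contrapT => nex.
pose s := enum (A :\ x).
have es : [set:: s] = A :\ x by apply/setP=> z; rewrite inE mem_enum.
have us : uniq (x :: s) by rewrite /= enum_uniq mem_enum !inE eqxx.
have exs : [set:: x :: s] = A by rewrite set_cons es setD1K.
have key t : uniq t -> [set:: t] = B -> 0 <= plucker c (x :: s) * plucker c t.
  move=> ut et; apply: h4 => i lti.
  have [->|/plucker_eq0[u1 n1]] := eqVneq (plucker c (nth x t i :: s)) 0.
    by rewrite mul0r.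
  have [->|/plucker_eq0[u2 n2]] := eqVneq (plucker c (set_nth x t i x)) 0.
    by rewrite mulr0.
  have tB : nth x t i \in B by rewrite -et inE mem_nth.
  case: nex; exists (nth x t i).
    rewrite inE tB andbT; case/andP: u1; rewrite mem_enum !inE.
    by case: eqP => // e; move: xB; rewrite -e tB.
  suff <- : [set:: set_nth x t i x] = x |: B :\ nth x t i by [].
  apply/setP=> z; rewrite set_nthE lti -et !inE mem_cat inE.
  have et' := cat_take_drop i t; rewrite (drop_nth x lti) in et'.
  have -> : z \in t = [|| z \in take i t, z == nth x t i | z \in drop i.+1 t].
    by rewrite -{1}et' mem_cat inE.
  have := ut; rewrite -{1}et' cat_uniq /=.
  case/and3P=> _; rewrite negb_or => /andP[n1' _] /andP[n2' _].
  case: (z == x); rewrite ?orbT //=; case: eqP => [->|//].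
  by rewrite (negPf n1') (negPf n2').
have nz t : uniq t -> [set:: t] = B -> plucker c t != 0.
  by move=> ut et; rewrite plucker_uniq_eq0 // et.
have nzs : plucker c (x :: s) != 0 by rewrite plucker_uniq_eq0 // exs.
pose t := enum B.
have ut : uniq t by exact: enum_uniq.
have et : [set:: t] = B by apply/setP=> z; rewrite inE mem_enum.
case: t ut et => [|b1 [|b2 t]] ut et.
- have := h3 _ _ bA bB; rewrite -et (_ : [set:: [::]] = set0) ?cards0.
    by move/eqP; rewrite cards_eq0 => /eqP A0; rewrite A0 inE in xA.
  by apply/setP=> z; rewrite !inE.
- have eB : B = [set b1] by rewrite -et; apply/setP=> z; rewrite !inE.
  have := h3 _ _ bA bB; rewrite eB cards1 => /eqP/cards1P[z eA].
  have {}eA : A = [set x] by move: xA; rewrite eA inE => /eqP->.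
  case: nex; exists b1; last by rewrite eB setDv setU0 -eA.
  by rewrite eB eA !inE eqxx andbT; apply: contraNneq xB => <-; rewrite eB inE.
have n : plucker c [:: b2, b1 & t] = - plucker c [:: b1, b2 & t].
  rewrite /plucker.
  have -> : [set:: [:: b2, b1 & t]] = [set:: [:: b1, b2 & t]].
    by apply/setP=> z; rewrite !inE orbCA.
  rewrite -mulNr; congr (_ * _).
  rewrite !eseq_cons !mulrA.
  suff -> : evec int b2 * evec int b1 = - (evec int b1 * evec int b2).
    by rewrite mulNr ffunE.
  case/andP: ut; rewrite inE negb_or => /andP[n12 _] _.
  rewrite !esetM !disjoints1 !inE n12 eq_sym n12 setUC -scaleNr; congr (_ *: _).
  rewrite /invs !big_set1.
  case: ltngtP => //.
  by move/val_inj/enum_rank_inj => e; rewrite e eqxx in n12.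
have p1 := key _ ut et.
have ut' : uniq [:: b2, b1 & t].
  by move: ut; rewrite /= !inE !negb_or eq_sym => /andP[/andP[-> ->] /andP[-> ->]].
have et' : [set:: [:: b2, b1 & t]] = B.
  by rewrite -et; apply/setP=> z; rewrite !inE orbCA.
have := key _ ut' et'; rewrite n mulrN oppr_ge0 => p2.
have : plucker c (x :: s) * plucker c [:: b1, b2 & t] == 0 by rewrite eq_le p1 p2.
by rewrite mulf_eq0 (negPf nzs) (negPf (nz _ ut et)).
Qed.

Lemma basis_card M A B : basis M A -> basis M B -> #|A| = #|B|.
Proof. by have [_ _ _ h _] := chiP (repr M); apply: h. Qed.

Lemma basis_sub M B : basis M B -> B \subset ground M.
Proof. by have [_ _ h _ _] := chiP (repr M); apply: h. Qed.

(* A basis whose intersection with [A] is a basis of [A]. *)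
Definition rank_basis (M : om) A : {set T} :=
  odflt set0 [pick B : {set T} | basis M B && (#|B :&: A| == rank M A)].

Lemma rank_basisP M A :
  basis M (rank_basis M A) /\ #|rank_basis M A :&: A| = rank M A.
Proof.
rewrite /rank_basis; case: pickP => [B /andP[bB /eqP]//|no].
have [B0 bB0] := ex_basis M.
have [] := eq_bigmax_cond (fun B : {set T} => #|B :&: A|) (A := basis M).
  by apply/card_gt0P; exists B0.
by move=> B bB e; have := no B; rewrite [X in X && _]bB /= /rank e eqxx.
Qed.

(* Contraction of [A]: chi(s I) for sequences [s] outside [A], where [I] is a
   maximal independent subset of [A]. *)
Fact contract_subproof M A : `[< is_chirotope (ground M :\: A)
  (slice (chi (repr M)) (ground M :\: A) (rank_basis M A :&: A)) >].
Proof.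
have [b _] := rank_basisP M A; apply/asboolP.
apply: (slice_chirotope (chiP (repr M)) b); first exact: subsetIl.
by rewrite setDIr setDv set0U; apply/setSD/basis_sub.
Qed.

Definition contract M A : om := \pi_om (exist _ (_, _) (contract_subproof M A)).

(* Deletion of [D]: chi(s J) for sequences [s] outside [D], where [J] is a
   minimal subset of [D] that together with the complement of [D] spans; it is
   [B :&: D] for a basis [B] meeting the complement of [D] in a basis of it. *)
Fact delete_subproof M D : `[< is_chirotope (ground M :\: D)
  (slice (chi (repr M)) (ground M :\: D)
     (rank_basis M (ground M :\: D) :&: D)) >].
Proof.
have [b _] := rank_basisP M (ground M :\: D); apply/asboolP.
apply: (slice_chirotope (chiP (repr M)) b); first exact: subsetIl.
by rewrite setDIr setDv set0U; apply/setSD/basis_sub.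
Qed.

Definition delete M D : om := \pi_om (exist _ (_, _) (delete_subproof M D)).

Definition restrict M X : om := delete M (ground M :\: X).

(* [X] is a separator when [M] is the direct sum of its restrictions to [X] and
   to the complement of [X]. *)
Definition separator M X : bool :=
  (X \subset ground M) &&
  (rank M X + rank M (ground M :\: X) == rank M (ground M))%N.

Definition connected M : bool :=
  [forall X : {set T}, separator M X ==> (X == set0) || (X == ground M)].

(* The connected components are the minimal nonempty separators. *)
Definition components M : {set {set T}} :=
  [set X | minset (fun Y => (Y != set0) && separator M Y) X].

Lemma rank_ge M B X : basis M B -> (#|B :&: X| <= rank M X)%N.
Proof. by move=> bB; apply: (@leq_bigmax_cond _ (basis M)). Qed.

Lemma cardIU (A X Y : {set T}) : [disjoint X & Y] ->
  #|A :&: (X :|: Y)| = (#|A :&: X| + #|A :&: Y|)%N.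
Proof.
move=> d; rewrite setIUr -cardsUI setIACA setIid (disjoint_setI0 d) setI0.
by rewrite cards0 addn0.
Qed.

Lemma rankU M X Y : [disjoint X & Y] ->
  (rank M (X :|: Y) <= rank M X + rank M Y)%N.
Proof.
move=> d; have [b <-] := rank_basisP M (X :|: Y).
by rewrite cardIU // leq_add ?rank_ge.
Qed.

Lemma disjointsD (A B : {set T}) : [disjoint A & B :\: A].
Proof. by rewrite -setI_eq0; apply/eqP/setP=> z; rewrite !inE; case: (z \in A). Qed.

Lemma separator_card M X B : separator M X -> basis M B ->
  #|B :&: X| = rank M X.
Proof.
case/andP=> sX /eqP e bB; apply/eqP; rewrite eqn_leq rank_ge //=.
have [b rB] := rank_basisP M (ground M).
rewrite -(leq_add2r (rank M (ground M :\: X))) e -rB.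
rewrite (setIidPl (basis_sub b)) (basis_card b bB).
rewrite -{1}(setIidPl (basis_sub bB)) -{1}(setUDK sX) cardIU ?disjointsD //.
by rewrite leq_add2l rank_ge.
Qed.

Lemma ground_restrict M X : X \subset ground M -> ground (restrict M X) = X.
Proof.
move=> sX; rewrite ground_pi /gset /= setDDr setDv set0U.
by apply/setIidPr.
Qed.

Lemma separator_swap M X B Z : separator M X -> basis M B -> basis M Z ->
  basis M ((B :&: X) :|: (Z :\: X)).
Proof.
move=> sX bB bZ; have [n] := ubnP #|(Z :\: X) :\: B|.
elim: n B bB => // n IHn B bB; rewrite ltnS => le_n.
have cD (B' : {set T}) : basis M B' -> #|B' :\: X| = (#|Z| - rank M X)%N.
  by move=> b; rewrite -(separator_card sX b) -(basis_card b bZ) -(cardsID X B') addKn.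
have [e0|[x]] := set_0Vmem ((Z :\: X) :\: B).
  suff -> : Z :\: X = B :\: X by rewrite setID.
  apply/eqP; rewrite eqEcard !cD // leqnn andbT.
  apply/subsetP=> z zB; move/setP/(_ z): e0; move: zB; rewrite !inE.
  by case/andP=> -> ->; rewrite !andbT; move/negbFE.
rewrite !inE => /and3P[xB xX xZ].
have [y yD bB'] := basis_exchange bZ bB xZ xB.
have [yZ yB] : y \notin Z /\ y \in B by move: yD; rewrite inE => /andP.
have yx : y != x by apply: contraNneq yZ => ->.
have yX : y \notin X.
  apply/negP=> yX; have := separator_card sX bB'; rewrite -(separator_card sX bB).
  have -> : (x |: B :\ y) :&: X = (B :&: X) :\ y.
    apply/setP=> z; rewrite !inE; case: (eqVneq z x) => [->|_] /=.
      by rewrite (negPf xX) (negPf xB) !andbF.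
    by rewrite andbA.
  by rewrite (cardsD1 y (B :&: X)) inE yB yX => /eqP; rewrite -[X in X == _]add0n eqn_add2r.
have := IHn _ bB'.
have -> : (x |: B :\ y) :&: X = B :&: X.
  apply/setP=> z; rewrite !inE; case: (eqVneq z x) => [->|_] /=.
    by rewrite (negPf xX) !andbF.
  by case: (eqVneq z y) => [->|//] /=; rewrite (negPf yX) andbF.
apply; apply: leq_trans le_n; rewrite [X in (_ < X)%N](cardsD1 x).
rewrite !inE xB xX xZ /= add1n ltnS; apply/subset_leq_card/subsetP=> z.
rewrite !inE negb_or negb_and negbK => /andP[/andP[-> h] /andP[-> zZ]].
rewrite zZ /= andbT; case/orP: h => // /eqP e; by rewrite -e zZ in yZ.
Qed.

Lemma rank_restrict M X Y : separator M X -> Y \subset X ->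
  rank (restrict M X) Y = rank M Y.
Proof.
move=> sX sYX; have sXg : X \subset ground M by case/andP: sX.
set D := ground M :\: X.
have gD : ground M :\: D = X by rewrite /D setDDr setDv set0U; apply/setIidPr.
pose Z := rank_basis M X; have [bZ _] := rank_basisP M X.
have ZD : Z :&: D = Z :\: X.
  apply/setP=> z; rewrite !inE; case zZ: (z \in Z); rewrite ?andbF //= andbT.
  by rewrite (subsetP (basis_sub bZ)) ?andbT.
have bR B : basis (restrict M X) B =
    (slice (chi (repr M)) X (Z :\: X) B != 0).
  by rewrite /basis /restrict /delete chi_pi0 /chi /= gD -/Z ZD.
apply/eqP; rewrite eqn_leq; apply/andP; split.
  have [b <-] := rank_basisP (restrict M X) Y.
  move: b; rewrite bR => /slice_neq0[_ _ b].
  by apply: leq_trans (rank_ge Y b); rewrite subset_leq_card ?setSI ?subsetUl.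
have [bB <-] := rank_basisP M Y; set B := rank_basis M Y in bB *.
have b : basis (restrict M X) (B :&: X).
  rewrite bR slice_neq0I ?subsetIr //.
    by rewrite (disjointWl (subsetIr _ _)) ?disjointsD.
  exact: separator_swap.
apply: leq_trans (rank_ge Y b); rewrite subset_leq_card //.
by rewrite -setIA (setIidPr sYX).
Qed.

Lemma component_separator M X : X \in components M ->
  separator M X /\ X != set0.
Proof. by rewrite inE => /minsetP[/andP[]]. Qed.

Lemma component_connected M X : X \in components M -> connected (restrict M X).
Proof.
move=> cX; have [sX X0] := component_separator cX.
have sXg : X \subset ground M by case/andP: sX.
apply/forallP=> Y; apply/implyP; rewrite /separator ground_restrict //.
case/andP=> sYX; rewrite !rank_restrict ?subsetDl // => /eqP e.
have [->//|Y0 /=] := eqVneq Y set0; move: cX; rewrite inE => /minsetP[_ mX].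
apply/eqP/mX => //; rewrite Y0 /= /separator (subset_trans sYX sXg) /=.
rewrite eqn_leq; apply/andP; split; last first.
  rewrite -{1}(setUDK (subset_trans sYX sXg)); exact/rankU/disjointsD.
case/andP: (sX) => _ /eqP <-; rewrite -e -addnA leq_add2l.
have -> : ground M :\: Y = (X :\: Y) :|: (ground M :\: X).
  apply/setP=> z; rewrite !inE; case zX: (z \in X); case zY: (z \in Y) => //=.
  - by rewrite (subsetP sXg).
  - by move/negP: zX; case; apply: (subsetP sYX).
by apply/rankU/(disjointWl (subsetDl _ _))/disjointsD.
Qed.


End OrientedMatroids.

Section Extensors.
Variables (K : fieldType) (T : finType).
Implicit Types (S : {set T}) (N : exterior K T) (eps : seq T -> int).

Definition extensor S N : Prop :=
  (exists a : K, N = a *: 1) \/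
  (exists vs : seq (T -> K), N = \prod_(v <- vs) \sum_(s in S) v s *: evec K s).

Definition unimodular N : Prop :=
  forall s : seq T, plucker N s \in [:: 0; 1; -1].

(* [inc] embeds [K] into the real numbers; it only serves to define signs. *)
Definition sign_ext (F : realType) (inc : {rmorphism K -> F}) N : exterior int T :=
  [ffun A => sgz (inc (N A))].

Definition presents (F : realType) (inc : {rmorphism K -> F}) S N (M : om T) : Prop :=
  [/\ extensor S N, N != 0, ground M = S &
      chi (repr M) = sign_ext inc N \/ chi (repr M) = - sign_ext inc N].

Definition econtract1 N (e : T) : exterior K T :=
  [ffun B : {set T} => plucker N (rcons (enum B) e)].

Definition econtract N (s : seq T) : exterior K T :=
  foldr (fun e N' => econtract1 N' e) N s.

Definition orientation S eps : Prop :=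
  [/\ eps [::] = 1,
      forall s, {subset s <= S} -> uniq s -> eps s = 1 \/ eps s = -1,
      forall s, {subset s <= S} -> ~~ uniq s -> eps s = 0 &
      forall s1 s2 s3 x y, {subset s1 ++ x :: s2 ++ y :: s3 <= S} ->
        eps (s1 ++ x :: s2 ++ y :: s3) = - eps (s1 ++ y :: s2 ++ x :: s3)].

Definition dual eps S N : exterior K T :=
  [ffun X : {set T} => if X \subset S then
     plucker N (enum (S :\: X)) * (eps (enum (S :\: X) ++ enum X))%:~R else 0].

End Extensors.

(* Contains the two disjoint copies of the ports, and the other elements. *)
Definition doubled (T : finType) : finType := (T + T + T)%type.
Definition port_iota (T : finType) (p : T) : doubled T := inl (inl p).
Definition port_upsilon (T : finType) (p : T) : doubled T := inl (inr p).
Definition elt (T : finType) (e : T) : doubled T := inr e.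

Section PortedExtensors.
Variables (K L : fieldType) (f : {rmorphism K -> L}) (T : finType).
Variables (eps : seq T -> int) (g r : T -> L).
Implicit Types (P E : seq T) (N : exterior K T).

(* The algebra homomorphism, over the coefficient extension [f], induced by a
   map [h] on the basis vectors. *)
Definition ehom (U : finType) (h : T -> exterior L U) N : exterior L U :=
  \sum_(A : {set T}) f (N A) *: \prod_(t <- enum A) h t.

Definition iota_g P : exterior K T -> exterior L (doubled T) :=
  ehom (fun t => if t \in P then evec L (port_iota t) else g t *: evec L (elt t)).

Definition upsilon_r P : exterior K T -> exterior L (doubled T) :=
  ehom (fun t => if t \in P then evec L (port_upsilon t) else r t *: evec L (elt t)).

(* When [E] is empty the ground set is [P] and [g], [r] play no role. *)
Definition Mext P E N : exterior L (doubled T) :=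
  iota_g P N * upsilon_r P (dual eps [set:: P ++ E] N).

Definition ME P E N : exterior L (doubled T) :=
  econtract (Mext P E N) (map (@elt T) E).

End PortedExtensors.

Definition om_var (T : finType) (P : {set T}) :=
  {Q : om T | [&& connected Q, ground Q != set0 & ground Q \subset P]}.

(* The default value is never used, see [component_varP]. *)
Definition var_monom (T : finType) (P : {set T}) (Q : om T) : {cmonom om_var P} :=
  if insub Q is Some q then ucm q else mone.

Definition om_monom (T : finType) (P : {set T}) (M : om T) : {cmonom om_var P} :=
  \big[mmul/mone]_(X in components M) var_monom P (restrict M X).

Lemma component_varP (T : finType) (P : {set T}) (M : om T) (X : {set T}) :
    ground M \subset P -> X \in components M ->
  exists2 q : om_var P, val q = restrict M X & var_monom P (restrict M X) = ucm q.
Proof.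
move=> sMP cX; have [/andP[sX _] X0] := component_separator cX.
have h : [&& connected (restrict M X), ground (restrict M X) != set0
           & ground (restrict M X) \subset P].
  by rewrite component_connected // ground_restrict // X0 (subset_trans sX).
exists (Sub (restrict M X) h); first exact: SubK.
by rewrite /var_monom insubT.
Qed.

(* Contract [A] and delete the other elements of [E]. *)
Definition minor (T : finType) (M : om T) (E : seq T) (A : {set T}) : om T :=
  delete (contract M A) ([set:: E] :\: A).

Section PolynomialR.
Variables (L : fieldType) (T : finType).

(* Polynomials with one variable for each element of [om_var P]; the variables
   u (the outer one) and v (the inner one) are in the coefficients. *)
Definition Rring (P : {set T}) := {malg {poly {poly L}}[{cmonom om_var P}]}.

Definition Rpoly (g r : T -> L) (P E : seq T) (M : om T) : Rring [set:: P] :=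
  let u : {poly {poly L}} := 'X in
  let v : {poly {poly L}} := 'X%:P in
  let rho := rank M in
  let rk (Q : om T) := rank Q (ground Q) in
  \sum_(A in powerset [set:: E])
    << ((\prod_(e in A) g e) * (\prod_(e in [set:: E] :\: A) r e))%:P%:P
         * u ^+ (rk M - rk (minor M E A) - rho A) * v ^+ (#|A| - rho A)
       *g om_monom [set:: P] (minor M E A) >>.

(* The linear substitution u = v = 0, with each monomial [m] replaced by [h m]. *)
Definition subst_uv0 (P : {set T}) (V : lmodType L)
    (h : {cmonom om_var P} -> V) (R : Rring P) : V :=
  \sum_(m <- finmap.enum_fset (msupp R)) (R@_m).[0].[0] *: h m.

End PolynomialR.

Section Replacement.
Variables (F : realType) (K L : fieldType).
Variables (inc : {rmorphism K -> F}) (f : {rmorphism K -> L}) (T : finType).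
Variables (eps : seq T -> int) (g r : T -> L) (P E : seq T).

Definition unimodular_presentation (S : {set T}) (N : exterior K T) (M : om T) : Prop :=
  presents inc S N M /\ unimodular N.

Definition port_extensor (N : exterior K T) : exterior L (doubled T) :=
  (eps P * eps (P ++ E))%:~R *: ME f eps g r P [::] N.

(* The extensor substituted for a monomial of the form [om_monom [set:: P] Q],
   computed from a chosen presentation; other monomials are sent to 0. *)
Definition replace_monom (m : {cmonom om_var [set:: P]}) : exterior L (doubled T) :=
  port_extensor (classical_sets.xget 0 (fun N => exists2 Q,
    unimodular_presentation [set:: P] N Q & om_monom [set:: P] Q = m)).

End Replacement.

(* Main.v *)
(** Expanding [iota_g N] and [upsilon_r (dual N)] by the sets [A] and [A'] of
    non-port elements that occur, and contracting by [E], only the terms where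
    [A'] is the complement of [A] in [E] survive, and such a term involves [N]
    only through its coordinates [N[CA]] with [C] a set of ports.  The signs are
    handled by one principle: the product of two alternating functions of a
    sequence is symmetric.  Moving [A] past the port elements in both the
    orientation and the exterior product at once yields the factor
    [eps P * eps (P ++ E)] times [M_0] of the extensor [C |-> N[CA]].  That extensor is
    nonzero exactly when some basis meets [E] in [A], i.e. when the exponents of
    [u] and [v] vanish, and it then presents the minor [N/A|P].

    That the replacement of monomials is well defined means that a chirotope is
    determined up to sign by its restrictions to the connected components.  Bases
    can be exchanged component by component, and for an exchange of [y] by [x]
    inside a separator the chirotope axiom shows that the ratio of the two signs
    does not depend on the part of the basis outside the separator. *)

Require Import Defs.
From HB Require Import structures.
From mathcomp Require Import all_boot all_order all_algebra generic_quotient.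
From mathcomp Require Import boolp reals.
From mathcomp Require classical_sets finmap.
From mathcomp.multinomials Require Import monalg.

Import Order.TTheory GRing.Theory Num.Theory.
Local Open Scope ring_scope.

Set Implicit Arguments.
Unset Strict Implicit.
Unset Printing Implicit Defensive.


(** Adjacent transpositions generate all permutations. Symmetry is only assumed on rearrangements of
    [s], because an orientation is alternating only on sequences within its ground set. *)
Lemma perm_swap_inv (T : eqType) (V : Type) (F : seq T -> V) (s s' : seq T) :
    (forall a x y b, perm_eq (a ++ x :: y :: b) s ->
       F (a ++ x :: y :: b) = F (a ++ y :: x :: b)) ->
  perm_eq s s' -> F s = F s'.
Proof.
elim: s s' F => [|x s IHs] s' F symF.
  by rewrite perm_sym => /perm_nilP->.
move=> pss'; have xs' : x \in s' by rewrite -(perm_mem pss') mem_head.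
case/splitPr: xs' pss' => a b pss'.
have ps : perm_eq s (a ++ b).
  by rewrite -(perm_cons x) (perm_trans pss') // (perm_catCA a [:: x] b).
rewrite (IHs _ (fun s => F (x :: s)) _ ps) => [|a' u v b' pa]; last first.
  by apply: (symF (x :: a')); rewrite perm_cons.
have {}pss' : perm_eq ([::] ++ a ++ x :: b) (x :: s) by rewrite perm_sym.
(* The head [x] is carried past one element of [a] at a time; the prefix [c] collects those already
   passed. *)
suff H c : perm_eq (c ++ a ++ x :: b) (x :: s) ->
  F (c ++ x :: a ++ b) = F (c ++ a ++ x :: b) by apply: (H [::]).
elim: a c {ps pss'} => [//|y a IHa] c pc.
have e : perm_eq (x :: y :: a ++ b) (y :: a ++ x :: b).
  exact: (permEl (perm_catCA [:: x] (y :: a) b)).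
rewrite /= symF; last by apply: perm_trans pc; rewrite perm_cat2l.
rewrite -(cat_rcons y c (x :: a ++ b)) -(cat_rcons y c (a ++ x :: b)).
by apply: IHa; rewrite cat_rcons.
Qed.

(** * Exterior algebra *)

Section Exterior.
Variables (R : comNzRingType) (T : finType).
Local Notation X := (exterior R T).
Implicit Types (x y : X) (s : seq T) (A B C S : {set T}).

Lemma evec_sq (t : T) : evec R t * evec R t = 0.
Proof. by rewrite esetM disjoints1 inE eqxx. Qed.

Lemma evecC (t u : T) : evec R t * evec R u = - (evec R u * evec R t).
Proof.
have [->|n] := eqVneq t u; first by rewrite evec_sq oppr0.
rewrite !esetM !disjoints1 !inE n eq_sym n setUC -scaleNr; congr (_ *: _).
rewrite /invs !big_set1; case: ltngtP; rewrite ?opprK //.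
by move/val_inj/enum_rank_inj => e; rewrite e eqxx in n.
Qed.

Lemma eseq_swap (a b : seq T) (t u : T) :
  eseq R (a ++ t :: u :: b) = - eseq R (a ++ u :: t :: b).
Proof.
by rewrite !eseq_cat !eseq_cons !mulrA -(mulrA _ (evec R t)) evecC mulrN mulNr !mulrA.
Qed.

Lemma set_seq_perm s s' : perm_eq s s' -> [set:: s] = [set:: s'].
Proof. by move=> /perm_mem e; apply/setP=> x; rewrite !inE. Qed.

Lemma perm_swap (a b : seq T) (t u : T) :
  perm_eq (a ++ t :: u :: b) (a ++ u :: t :: b).
Proof. by rewrite perm_cat2l; apply: (permEl (perm_catCA [:: t] [:: u] b)). Qed.

Lemma plucker_swap x (a b : seq T) (t u : T) :
  plucker x (a ++ t :: u :: b) = - plucker x (a ++ u :: t :: b).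
Proof.
by rewrite /plucker eseq_swap (set_seq_perm (perm_swap a b t u)) ffunE mulNr.
Qed.

Lemma set_enum A : [set:: enum A] = A.
Proof. by apply/setP=> z; rewrite inE mem_enum. Qed.

Lemma plucker_enum x A : plucker x (enum A) = x A.
Proof. by rewrite /plucker eseq_enum set_enum ffunE eqxx mul1r. Qed.

Lemma plucker_nuniq x s : ~~ uniq s -> plucker x s = 0.
Proof. by move=> nu; rewrite /plucker eseq_nuniq // ffunE mul0r. Qed.

Lemma plucker_neq0 x s : plucker x s != 0 -> uniq s /\ x [set:: s] != 0.
Proof.
move=> n0; suff us : uniq s by rewrite -plucker_uniq_eq0.
by apply: contraR n0 => nu; rewrite plucker_nuniq.
Qed.

Lemma pluckerD x y s : plucker (x + y) s = plucker x s + plucker y s.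
Proof. by rewrite /plucker ffunE mulrDr. Qed.

Lemma pluckerZ a x s : plucker (a *: x) s = a * plucker x s.
Proof. by rewrite /plucker ffunE [_ *: _]/(a * _) mulrCA. Qed.

Lemma pluckerN x s : plucker (- x) s = - plucker x s.
Proof. by rewrite /plucker ffunE mulrN. Qed.

Lemma plucker0 s : plucker (0 : X) s = 0.
Proof. by rewrite /plucker ffunE mulr0. Qed.

(* Contracts [z] and deletes everything outside [S]; over [int] and for
   [z = enum Z] this is convertible to [slice x S Z]. *)
Definition eslice x S (z : seq T) : X :=
  [ffun B : {set T} => if B \subset S then plucker x (enum B ++ z) else 0].

(** The sign that sorts [s] is the same with or without the tail [z], so the formula passes from
    [enum B] to every order. *)
Lemma plucker_eslice x S z s :
  plucker (eslice x S z) s = if all (mem S) s then plucker x (s ++ z) else 0.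
Proof.
rewrite {1}/plucker ffunE set_seqE; case: ifP => _; last exact: mulr0.
rewrite /plucker set_enum_cat !eseq_cat mulrA; congr (_ * _).
by rewrite eseq_enum [in RHS]eseqE -wedgeZl [in RHS]ffunE.
Qed.

Lemma eslice_eslice x S z S' z' : S' \subset S -> all (mem S) z' ->
  eslice (eslice x S z) S' z' = eslice x S' (z' ++ z).
Proof.
move=> sS az; apply/ffunP=> B; rewrite !ffunE; case: ifP => // sB.
rewrite plucker_eslice all_cat az andbT catA.
suff -> : all (mem S) (enum B) by [].
by apply/allP=> t; rewrite mem_enum => /(subsetP sB) /(subsetP sS).
Qed.

Lemma esliceN x S z : eslice (- x) S z = - eslice x S z.
Proof. by apply/ffunP=> B; rewrite !ffunE pluckerN; case: ifP; rewrite ?oppr0. Qed.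

End Exterior.

(** * Contraction of exterior elements along a sequence *)

Section Contract.
Variables (K : fieldType) (T : finType).
Implicit Types (N : exterior K T) (s z : seq T).

Lemma plucker_econtract N z s : plucker (econtract N z) s = plucker N (s ++ z).
Proof.
elim: z s => [|e z IHz] s /=; first by rewrite cats0.
have -> : econtract1 (econtract N z) e = eslice (econtract N z) setT [:: e].
  by apply/ffunP=> B; rewrite !ffunE subsetT cats1.
rewrite plucker_eslice IHz -catA.
by have -> : all (mem [set: T]) s by apply/allP=> t; rewrite inE.
Qed.

Lemma econtractE N z B : econtract N z B = plucker N (enum B ++ z).
Proof. by rewrite -plucker_econtract plucker_enum. Qed.

Lemma econtractD (x y : exterior K T) z : econtract (x + y) z = econtract x z + econtract y z.
Proof. by apply/ffunP=> B; rewrite econtractE pluckerD [RHS]ffunE !econtractE. Qed.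

Lemma econtractZ a (x : exterior K T) z : econtract (a *: x) z = a *: econtract x z.
Proof. by apply/ffunP=> B; rewrite econtractE pluckerZ [RHS]ffunE !econtractE. Qed.

Lemma econtract0 z : econtract (0 : exterior K T) z = 0.
Proof. by apply/ffunP=> B; rewrite econtractE plucker0 ffunE. Qed.

Lemma econtract_sum (I : finType) (p : pred I) (F : I -> exterior K T) z :
  econtract (\sum_(i | p i) F i) z = \sum_(i | p i) econtract (F i) z.
Proof.
by apply: (big_morph (fun x => econtract x z)) => [x y|];
  rewrite ?econtractD ?econtract0.
Qed.

Lemma econtract1_free N e : (forall B : {set T}, e \in B -> N B = 0) -> econtract1 N e = 0.
Proof.
move=> h; apply/ffunP=> B; rewrite !ffunE /plucker h ?mulr0 //.
by rewrite inE mem_rcons mem_head.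
Qed.

(** The sign of placing [e] last occurs once in the product and once in the coordinate, and
    cancels. *)
Lemma econtract1_mul N e : (forall B : {set T}, e \in B -> N B = 0) ->
  econtract1 (N * evec K e) e = N.
Proof.
move=> h; apply/ffunP=> B; rewrite ffunE.
have [eB|neB] := boolP (e \in B).
  by rewrite h // plucker_nuniq // rcons_uniq mem_enum eB.
have dB : [disjoint B & [set e]] by rewrite disjoint_sym disjoints1.
have eU : [set:: rcons (enum B) e] = B :|: [set e].
  by apply/setP=> t; rewrite !inE mem_rcons inE mem_enum orbC.
rewrite /plucker eU -cats1 eseq_cat eseq_enum [eseq K [:: e]]big_seq1 esetM dB.
rewrite !ffunE eqxx.
rewrite (bigD1 B) ?subsetUl //= big1 ?addr0.
  rewrite setDUl setDv set0U (setDidPl _) 1?disjoint_sym // !ffunE eqxx.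
  rewrite [_ *: _]mulr1 mulr1 mulrA -expr2 sqrr_sign; exact: mul1r.
move=> A /andP[sA nA]; rewrite ffunE; case: eqP => [e1|]; last by rewrite !mulr0.
case/negP: nA; apply/eqP/setP=> t; move/setP/(_ t): e1; rewrite !inE.
have := subsetP sA t; rewrite !inE.
by case: eqP => [->|_]; rewrite ?(negPf neB) /=; case: (_ \in A) => //=;
  case: (_ \in B) => //= /(_ isT).
Qed.

End Contract.


(** * Extensors are closed under contraction and deletion *)

Section Vectors.
Variables (K : fieldType) (T : finType).
Local Notation X := (exterior K T).
Implicit Types (x y N : X) (S P B : {set T}) (v w : T -> K) (vs : seq (T -> K)).

Definition vec S v : X := \sum_(s in S) v s *: evec K s.

(** Both claims go through one induction over [S]: in the square of a sum the cross terms cancel by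
    anticommutation. *)
Lemma vec_prop S v : vec S v * vec S v = 0 /\
  forall t, vec S v * evec K t = - (evec K t * vec S v).
Proof.
rewrite /vec; elim/big_rec: _ => [|s y _ [sq ac]].
  by split=> [|t]; rewrite ?mul0r ?mulr0 ?oppr0.
split=> [|t].
  rewrite mulrDl !mulrDr sq addr0 -!wedgeZl -!wedgeZr evec_sq !scaler0 add0r.
  by rewrite ac scalerN addrN.
by rewrite mulrDl mulrDr -wedgeZl -wedgeZr evecC ac scalerN opprD.
Qed.

Lemma vecC S v w : vec S v * vec S w = - (vec S w * vec S v).
Proof.
rewrite {2 3}/vec mulr_sumr mulr_suml -sumrN; apply: eq_bigr => t _.
by rewrite -wedgeZl -wedgeZr (vec_prop S v).2 scalerN.
Qed.

Lemma vec_prodC S v vs : exists k,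
  vec S v * \prod_(w <- vs) vec S w = (-1) ^+ k *: (\prod_(w <- vs) vec S w * vec S v).
Proof.
elim: vs => [|w vs [k IH]]; first by exists 0%N; rewrite big_nil mulr1 mul1r scale1r.
exists k.+1; rewrite big_cons mulrA (vecC S v w) mulNr.
rewrite -(mulrA (vec S w) (vec S v)) IH -wedgeZr mulrA.
by rewrite exprS mulN1r scaleNr.
Qed.

Lemma vecB S v w (c : K) : vec S (fun s => v s - c * w s) = vec S v - c *: vec S w.
Proof.
rewrite /vec scaler_sumr -sumrB; apply: eq_bigr => s _.
by rewrite scalerBl scalerA.
Qed.

Lemma vecZ S v (c : K) : vec S (fun s => c * v s) = c *: vec S v.
Proof. by rewrite /vec scaler_sumr; apply: eq_bigr => s _; rewrite scalerA. Qed.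

Definition free_of (e : T) x := forall B : {set T}, e \in B -> x B = 0.

Lemma free_of_mul e x y : free_of e x -> free_of e y -> free_of e (x * y).
Proof.
move=> fx fy B eB; rewrite ffunE big1 // => A _.
have [eA|nA] := boolP (e \in A); first by rewrite fx // mul0r mulr0.
by rewrite fy ?mulr0 // inE eB nA.
Qed.

Lemma free_of_prod e S vs : all (fun v => `[< free_of e (vec S v) >]) vs ->
  free_of e (\prod_(v <- vs) vec S v).
Proof.
elim: vs => [_|v vs IH /= /andP[/asboolP fv /IH fvs]].
  rewrite big_nil => B eB; rewrite ffunE.
  by case: eqP => // e0; move: eB; rewrite e0 inE.
by rewrite big_cons; apply: free_of_mul.
Qed.

Lemma vec_val S v B : vec S v B = \sum_(s in S) v s * (B == [set s])%:R.
Proof.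
rewrite /vec sum_ffunE; apply: eq_bigr => s _; by rewrite !ffunE.
Qed.

Lemma free_of_vec e S v : (e \in S -> v e = 0) -> free_of e (vec S v).
Proof.
move=> h B eB; rewrite vec_val big1 // => s sS.
case: eqP => [eBs|_]; rewrite ?mulr0 //.
by move: eB; rewrite eBs inE => /eqP e1; rewrite -e1 in sS *; rewrite h // mul0r.
Qed.

Lemma vec_split e S v : e \in S ->
  vec S v = vec S (fun s => if s == e then 0 else v s) + v e *: evec K e.
Proof.
move=> eS; rewrite /vec [LHS](bigD1 e) //= [in RHS](bigD1 e) //= eqxx scale0r add0r.
by rewrite addrC; congr (_ + _); apply: eq_bigr => s /andP[_ /negPf->].
Qed.

(* Gaussian elimination of the coordinate [e]. *)
Lemma prod_vec_elim e S vs : exists vs' : seq (T -> K),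
  all (fun v => `[< free_of e (vec S v) >]) vs' /\
  (\prod_(v <- vs) vec S v = \prod_(v <- vs') vec S v \/
   exists w, [/\ e \in S, w e != 0 &
     \prod_(v <- vs) vec S v = \prod_(v <- vs') vec S v * vec S w]).
Proof.
elim: vs => [|v vs [vs' [fr IH]]]; first by exists [::]; split=> //; left.
case: IH => [IH|[w [eS we IH]]].
  have [/andP[eS ve]|nev] := boolP ((e \in S) && (v e != 0)).
    (* [v] becomes the pivot: it moves to the right end, and the resulting sign is absorbed in
       it. *)
    exists vs'; split=> //; right.
    have [k hk] := vec_prodC S v vs'.
    exists (fun s => (-1) ^+ k * v s); split=> //.
      by rewrite mulf_neq0 // signr_eq0.
    by rewrite big_cons IH hk vecZ -wedgeZr.
  exists (v :: vs'); split; last by left; rewrite !big_cons IH.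
  rewrite /= fr andbT; apply/asboolP/free_of_vec => eS.
  by apply/eqP; move: nev; rewrite eS negbK.
(* Subtracting a multiple of the pivot [w] kills the coordinate at [e] and keeps the product, since
   a product in which [w] occurs twice is zero. *)
pose v' s := v s - v e / w e * w s.
exists (v' :: vs'); split; last right.
  rewrite /= fr andbT; apply/asboolP/free_of_vec => _.
  by rewrite /v' divfK ?subrr.
exists w; split=> //; rewrite !big_cons IH vecB mulrBl mulrBl mulrA.
have [k hk] := vec_prodC S w vs'.
rewrite -!wedgeZl hk -wedgeZl -(mulrA _ (vec S w) (vec S w)).
by rewrite (vec_prop S w).1 mulr0 !scaler0 subr0.
Qed.

(** After elimination at most one factor, the last, involves [e]. If none does, the contraction is
    zero; otherwise only the term with [w e *: evec K e] survives, and it leaves the [e]-free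
    product scaled by [w e]. *)
Lemma extensor_contract1 S N e : extensor S N -> extensor S (econtract1 N e).
Proof.
have cZ a x : econtract1 (a *: x) e = a *: econtract1 x e.
  exact: (econtractZ a x [:: e]).
have cD x y : econtract1 (x + y) e = econtract1 x e + econtract1 y e.
  exact: (econtractD x y [:: e]).
have c0 x : free_of e x -> econtract1 x e = 0 by apply: econtract1_free.
have ext0 : extensor S (0 : X) by left; exists 0; rewrite scale0r.
case=> [[a ->]|[vs ->]].
  rewrite cZ c0 ?scaler0 // => B eB; rewrite ffunE.
  by case: eqP => // e0; move: eB; rewrite e0 inE.
have [vs' [/free_of_prod fr [->|[w [eS we ->]]]]] := prod_vec_elim e S vs.
  by rewrite c0.
rewrite (vec_split w eS) mulrDr.
rewrite cD c0; last first.
  by apply: free_of_mul => //; apply: free_of_vec; rewrite eqxx.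
rewrite add0r -wedgeZr cZ econtract1_mul //.
case: vs' {fr} => [|v vs']; first by left; exists (w e); rewrite big_nil.
right; exists ((fun s => w e * v s) :: vs').
by rewrite !big_cons -[\sum_(s in S) _]/(vec S _) vecZ wedgeZl.
Qed.

Lemma extensor_contract S N z : extensor S N -> extensor S (econtract N z).
Proof. by move=> h; elim: z => //= e z; apply: extensor_contract1. Qed.

Definition del P x : X := [ffun B : {set T} => if B \subset P then x B else 0].

Lemma delM P x y : del P (x * y) = del P x * del P y.
Proof.
apply/ffunP=> C; rewrite !ffunE; case: ifP => sC.
  apply: eq_bigr => A sA; rewrite !ffunE (subset_trans sA sC).
  by rewrite (subset_trans (subsetDl _ _) sC).
rewrite big1 // => A sA; rewrite !ffunE.
case: ifP => sAP; last by rewrite mul0r mulr0.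
case: ifP => sCA; rewrite ?mulr0 //; case/negP: sC.
by rewrite -(setUDK sA) subUset sAP.
Qed.

Lemma extensor_del S P N : extensor S N -> extensor P (del P N).
Proof.
case=> [[a ->]|[vs ->]].
  left; exists a; apply/ffunP=> B; rewrite !ffunE.
  by case: eqP => [->|_]; rewrite ?sub0set // [_ *: _]mulr0 if_same.
(* Coordinates outside [S] are set to zero because the original sums run over [S], the new ones over
   [P]. *)
right; exists [seq (fun t => if t \in S then v t else 0) | v <- vs].
rewrite -[\prod_(v <- vs) _]/(\prod_(v <- vs) vec S v) big_map.
elim: vs => [|v vs IH].
  rewrite !big_nil; apply/ffunP=> B; rewrite !ffunE.
  by case: eqP => [->|_]; rewrite ?sub0set // if_same.
rewrite !big_cons delM IH; congr (_ * _).
rewrite -[RHS]/(vec P _); apply/ffunP=> B; rewrite ffunE !vec_val.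
rewrite (big_mkcond (mem S)) (big_mkcond (mem P)) /=.
case: ifP => sB.
  apply: eq_bigr => t _; case: (eqVneq B [set t]) => [e|]; last first.
    by rewrite !mulr0 !if_same.
  by move: sB; rewrite e sub1set => ->; case: ifP; rewrite ?mul0r.
rewrite big1 // => t _; case: ifP => // tP.
case: (eqVneq B [set t]) => [e|]; last by rewrite mulr0.
by rewrite e sub1set tP in sB.
Qed.

Lemma extensor_eslice S P N z : extensor S N -> extensor P (eslice N P z).
Proof.
move=> /(extensor_contract z)/(extensor_del P).
suff -> : del P (econtract N z) = eslice N P z by [].
by apply/ffunP=> B; rewrite !ffunE econtractE.
Qed.

End Vectors.



(** * Minors *)

Definition eqsgn (V : zmodType) (x y : V) := x = y \/ x = - y.

Section EqSgn.
Variable V : zmodType.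
Implicit Types x y z : V.

Lemma eqsgn_sym x y : eqsgn x y -> eqsgn y x.
Proof. by case=> ->; [left | right; rewrite opprK]. Qed.

Lemma eqsgn_trans y x z : eqsgn x y -> eqsgn y z -> eqsgn x z.
Proof.
case=> -> [->|->]; rewrite ?opprK; [by left | by right | by right | by left].
Qed.

End EqSgn.

Section Minors.
Variable T : finType.
Implicit Types (A B D X Y Z : {set T}) (M : om T) (E : seq T).

Lemma chi_pi (C : chirotope T) : eqsgn (chi (repr (\pi_(om T) C)%qT)) (chi C).
Proof. by have /andP[_ /orP[] /eqP ->] := repr_pi C; [left | right]. Qed.

Lemma eqsgn_eslice (R : comNzRingType) (x y : exterior R T) S z :
  eqsgn x y -> eqsgn (eslice x S z) (eslice y S z).
Proof. by case=> ->; [left | right; rewrite esliceN]. Qed.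

Lemma eqsgn_neq0 (c c' : exterior int T) B : eqsgn c c' -> (c B != 0) = (c' B != 0).
Proof. by case=> -> //; rewrite ffunE oppr_eq0. Qed.

Lemma chi_contract M A : eqsgn (chi (repr (contract M A)))
  (eslice (chi (repr M)) (ground M :\: A) (enum (rank_basis M A :&: A))).
Proof. exact: chi_pi. Qed.

Lemma chi_delete M D : eqsgn (chi (repr (delete M D)))
  (eslice (chi (repr M)) (ground M :\: D)
     (enum (rank_basis M (ground M :\: D) :&: D))).
Proof. exact: chi_pi. Qed.

Lemma ground_contract M A : ground (contract M A) = ground M :\: A.
Proof. exact: ground_pi. Qed.

Lemma ground_delete M D : ground (delete M D) = ground M :\: D.
Proof. exact: ground_pi. Qed.

Lemma rank_ground M B : basis M B -> rank M (ground M) = #|B|.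
Proof.
have [b <-] := rank_basisP M (ground M) => bB.
by rewrite (setIidPl (basis_sub b)) (basis_card b bB).
Qed.

Lemma ground_minor M E A : A \subset [set:: E] ->
  ground (minor M E A) = ground M :\: [set:: E].
Proof.
by move=> sA; rewrite ground_delete ground_contract setDDl setUDK.
Qed.

(** [Z1] is the maximal independent subset of [A] used by the contraction, [Z2] the part of
    [[set:: E] :\: A] that the deletion appends. The exponent of [u] is [#|Z2|] and that of [v] is
    [#|A :\: Z1|], so both vanish as soon as some ports complete [A] to a basis. *)
Lemma minor_chi M E A : A \subset [set:: E] ->
  exists Z1 Z2 : {set T},
  [/\ Z1 \subset A /\ #|Z1| = rank M A,
      (rank M (ground M) - rank (minor M E A) (ground (minor M E A)) - rank M A)%N
        = #|Z2|,
      eqsgn (chi (repr (minor M E A)))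
        (eslice (chi (repr M)) (ground M :\: [set:: E]) (enum Z2 ++ enum Z1)) &
      forall B, B \subset ground M :\: [set:: E] -> basis M (B :|: A) ->
        Z1 = A /\ Z2 = set0].
Proof.
move=> sA; set C := contract M A; set P := ground M :\: [set:: E].
pose D := [set:: E] :\: A.
have gP : ground C :\: D = P by rewrite ground_contract setDDl setUDK.
pose Z1 := rank_basis M A :&: A; pose Z2 := rank_basis C P :&: D.
have [b1 r1] := rank_basisP M A; have [b2 r2] := rank_basisP C P.
have c1 : eqsgn (chi (repr C)) (eslice (chi (repr M)) (ground M :\: A) (enum Z1)).
  exact: chi_contract.
have bC B : basis C B = (slice (chi (repr M)) (ground M :\: A) Z1 B != 0).
  exact: eqsgn_neq0.
have c2 : eqsgn (chi (repr (minor M E A))) (eslice (chi (repr C)) P (enum Z2)).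
  by rewrite /Z2 -gP; apply: chi_delete.
have sP : P \subset ground M :\: A by apply: setDS.
have sZ2 : Z2 \subset ground C.
  exact: subset_trans (subsetIl _ _) (basis_sub b2).
have c3 : eqsgn (chi (repr (minor M E A)))
    (eslice (chi (repr M)) P (enum Z2 ++ enum Z1)).
  apply: eqsgn_trans c2 _; rewrite -(eslice_eslice _ _ sP).
    exact: eqsgn_eslice.
  apply/allP=> t; rewrite mem_enum => /(subsetP sZ2).
  by rewrite ground_contract.
exists Z1, Z2; split=> //; first by rewrite subsetIr.
  (* A basis [B] of the minor extends by the disjoint sets [Z2] and [Z1] to a basis of [M]; counting
     gives the exponent of [u]. *)
  have [B bB] := ex_basis (minor M E A); rewrite (rank_ground bB).
  have := bB; rewrite /basis (eqsgn_neq0 _ c2) => /slice_neq0[_ d2].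
  rewrite -/(basis C _) bC => /slice_neq0[_ d1 bBZ].
  rewrite (rank_ground bBZ) -r1 -/Z1.
  by rewrite !cardsU !disjoint_setI0 // cards0 !subn0 -addnA addKn addnK.
move=> B sB bB.
(* A basis containing [A] makes [A] independent, so a maximal independent subset of [A] is all of
   it. *)
have e1 : Z1 = A.
  apply/eqP; rewrite eqEcard subsetIr r1.
  by have := rank_ge A bB; rewrite (setIidPr _) // subsetUr.
have dBA : [disjoint B & A].
  rewrite disjoint_sym; apply: disjointWl sA _; rewrite disjoint_sym.
  by apply: disjointWl sB _; rewrite disjoint_sym disjointsD.
have bCB : basis C B.
  by rewrite bC slice_neq0I ?e1 // (subset_trans sB).
(* The contraction has a basis [B] inside [P], so the chosen [rank_basis C P] lies inside [P] too
   and its part [Z2] in [D] is empty. *)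
split=> //; apply/eqP; rewrite -subset0; apply/subsetP=> t.
rewrite !inE => /and3P[tB tA tE].
have : rank_basis C P :&: P == rank_basis C P.
  rewrite eqEcard subsetIl r2 (basis_card b2 bCB).
  by have := rank_ge P bCB; rewrite (setIidPl sB).
by move/eqP/setP/(_ t); rewrite !inE tB tE.
Qed.

End Minors.

(** * Signs of coordinates and unimodular presentations of minors *)

Section Signs.
Variables (F : realType) (K : fieldType) (inc : {rmorphism K -> F}) (T : finType).
Implicit Types (N : exterior K T) (s z : seq T).

(** The sign that sorts [s] is chosen before the ring, which allows coordinates over [K] to be
    compared with their signs over [int]. *)
Lemma eseq_sign s : uniq s -> exists k, forall R : comNzRingType,
  eseq R s = (-1) ^+ k *: eset R [set:: s].
Proof.
elim: s => [_|t s IHs /= /andP[ts /IHs[k e]]].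
  exists 0%N => R; rewrite scale1r /eseq big_nil; apply/ffunP=> A; rewrite !ffunE.
  by congr (_ == _)%:R; apply/setP=> t; rewrite !inE.
exists (k + invs [set t] [set:: s])%N => R.
rewrite eseq_cons e -wedgeZr esetM set_cons disjoints1 inE ts scalerA.
by rewrite exprD.
Qed.

Lemma plucker_sign s : uniq s -> exists k, forall (R : comNzRingType) (x : exterior R T),
  plucker x s = (-1) ^+ k * x [set:: s].
Proof.
move=> /eseq_sign[k e]; exists k => R x.
by rewrite /plucker e !ffunE eqxx [_ *: _]mulr1.
Qed.

Lemma plucker_sign_ext N s : plucker (sign_ext inc N) s = sgz (inc (plucker N s)).
Proof.
have [/plucker_sign[k e]|nu] := boolP (uniq s); last first.
  by rewrite !plucker_nuniq // rmorph0 sgz0.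
by rewrite !e ffunE rmorphM rmorphXn rmorphN1 sgzM sgzX sgzN sgz1.
Qed.

Lemma eslice_sign_ext N S z :
  eslice (sign_ext inc N) S z = sign_ext inc (eslice N S z).
Proof.
apply/ffunP=> B; rewrite !ffunE plucker_sign_ext.
by case: ifP => //; rewrite rmorph0 sgz0.
Qed.

Lemma sign_extN N : sign_ext inc (- N) = - sign_ext inc N.
Proof. by apply/ffunP=> B; rewrite !ffunE rmorphN sgzN. Qed.

Lemma unimodularN N : unimodular N -> unimodular (- N).
Proof.
move=> h s; have := h s; rewrite pluckerN !inE eqr_oppLR oppr0 => /or3P[] /eqP->;
  by rewrite ?opprK ?eqxx ?orbT.
Qed.

Lemma unimodular_val N B : unimodular N -> N B \in [:: 0; 1; -1].
Proof. by move=> h; rewrite -plucker_enum. Qed.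

(** [inc] preserves the values 0, 1 and -1, and signs tell these apart. *)
Lemma sign_ext_inj N N' : unimodular N -> unimodular N' ->
  sign_ext inc N = sign_ext inc N' -> N = N'.
Proof.
move=> u u' e; apply/ffunP=> B; move/ffunP/(_ B): e; rewrite !ffunE.
have n1 : -1 != 1 :> int by [].
have := unimodular_val B u; have := unimodular_val B u'; rewrite !inE.
by case/or3P=> /eqP-> /or3P[] /eqP->; rewrite ?rmorphN ?rmorph1 ?rmorph0 ?sgzN ?sgz1 ?sgz0.
Qed.

Lemma eqsgn_sign_ext N N' : unimodular N -> unimodular N' ->
  eqsgn (sign_ext inc N) (sign_ext inc N') -> eqsgn N N'.
Proof.
move=> u u' [/(sign_ext_inj u u')|]; first by left.
by rewrite -sign_extN => /(sign_ext_inj u (unimodularN u')); right.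
Qed.

Lemma unimodular_eslice N S z : unimodular N -> unimodular (eslice N S z).
Proof.
by move=> u s; rewrite plucker_eslice; case: ifP => _; [apply: u | rewrite inE eqxx].
Qed.

Lemma sign_ext_eq0 N B : (sign_ext inc N B == 0) = (N B == 0).
Proof. by rewrite ffunE sgz_eq0 fmorph_eq0. Qed.

(** Taking signs commutes with slicing, so [N] is sliced the same way as the chirotope. The result
    is nonzero because [Q] has a basis. *)
Lemma unimodular_presentation_eslice S P N (M Q : om T) z :
    unimodular_presentation inc S N M -> ground Q = P ->
    eqsgn (chi (repr Q)) (eslice (chi (repr M)) P z) ->
  unimodular_presentation inc P (eslice N P z) Q.
Proof.
move=> [[extN _ _ chiM] uN] gQ chiQ.
have c : eqsgn (chi (repr Q)) (sign_ext inc (eslice N P z)).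
  by rewrite -eslice_sign_ext; apply: eqsgn_trans chiQ (eqsgn_eslice _ _ chiM).
split; last exact: unimodular_eslice.
split=> //; first exact: extensor_eslice extN.
have [B] := ex_basis Q; rewrite /basis (eqsgn_neq0 _ c) sign_ext_eq0.
by apply: contraNneq => ->; rewrite ffunE.
Qed.

End Signs.



(** * Connected components *)

Section Components.
Variable T : finType.
Implicit Types (A B D X Y Z : {set T}) (M Q : om T).

(** Converse of [separator_card]: bases have one size, so they also meet the complement of [X] in a
    constant number of elements, and the two ranks add up. *)
Lemma separator_const M X c : X \subset ground M ->
  (forall B, basis M B -> #|B :&: X| = c) -> separator M X.
Proof.
move=> sX h; rewrite /separator sX /=.
have [b1 <-] := rank_basisP M X; rewrite h //.
have [b2 <-] := rank_basisP M (ground M :\: X).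
rewrite (rank_ground b2) -(h _ b2) -(cardsID X (rank_basis M _)) eqn_add2l.
by rewrite setIDA (setIidPl (basis_sub b2)).
Qed.

Lemma separatorD M X Y : separator M X -> separator M Y -> Y \subset X ->
  separator M (X :\: Y).
Proof.
move=> sX sY sYX; apply: (@separator_const _ _ (rank M X - rank M Y)).
  by case/andP: sX => sX _; apply: subset_trans (subsetDl _ _) sX.
move=> B bB; rewrite -(separator_card sX bB) -(separator_card sY bB).
rewrite -(cardsID Y (B :&: X)) -setIA (setIidPr sYX) addKn.
by rewrite -setIDA.
Qed.

(** The component is a minimal separator [X] among those containing [x]. It is minimal among all
    nonempty separators, since a smaller [Y] avoiding [x] would leave the separator [X :\: Y], which
    still contains [x]. *)
Lemma component_cover M x : x \in ground M -> exists2 X, X \in components M & x \in X.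
Proof.
move=> xM; have sM : separator M (ground M).
  apply: (separator_const (c := rank M (ground M))) => // B bB.
  by rewrite (rank_ground bB) (setIidPl (basis_sub bB)).
have [|X mX _] := @minset_exists _ (fun Y => (x \in Y) && separator M Y) (ground M).
  by rewrite xM.
case/minsetP: mX => /andP[xX sX] minX.
exists X => //; rewrite inE; apply/minsetP; split.
  by rewrite sX andbT; apply/set0Pn; exists x.
move=> Y /andP[Y0 sY] sYX; have [xY|xnY] := boolP (x \in Y).
  by apply: minX => //; rewrite xY.
have e : X :\: Y = X.
  by apply: minX; rewrite ?subsetDl // inE xnY xX separatorD.
case/set0Pn: Y0 => y yY; have := subsetP sYX y yY.
by rewrite -e inE yY.
Qed.

Lemma chi_restrict M X : X \subset ground M ->
  eqsgn (chi (repr (restrict M X)))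
    (eslice (chi (repr M)) X (enum (rank_basis M X :\: X))).
Proof.
move=> sX; apply: eqsgn_trans (chi_delete _ _) _.
have eZ : rank_basis M X :&: (ground M :\: X) = rank_basis M X :\: X.
  by rewrite setIDA (setIidPl (basis_sub (rank_basisP M X).1)).
by rewrite setDDr setDv set0U (setIidPr sX) eZ; left.
Qed.

Lemma basis_restrictP M X B : separator M X -> basis M B ->
  basis (restrict M X) (B :&: X).
Proof.
move=> sX bB; have sXg : X \subset ground M by case/andP: sX.
rewrite /basis (eqsgn_neq0 _ (chi_restrict sXg)) slice_neq0I ?subsetIr //.
  by rewrite (disjointWl (subsetIr _ _)) ?disjointsD.
exact: separator_swap (rank_basisP M X).1.
Qed.

Lemma basis_glue M X A B : separator M X -> basis (restrict M X) A -> basis M B ->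
  basis M (A :|: (B :\: X)).
Proof.
move=> sX bA bB; have sXg : X \subset ground M by case/andP: sX.
move: bA; rewrite /basis (eqsgn_neq0 _ (chi_restrict sXg)) => /slice_neq0[sA _ bA].
have := separator_swap sX bA bB.
by rewrite setIUl (setIidPl sA) setIDAC setDIl setDv setI0 setU0.
Qed.

(** * Signs of exchanges inside a separator *)

Section Exchange.
Variables (M : om T) (X : {set T}).
Hypothesis sepX : separator M X.
Let c := chi (repr M).

Lemma plucker_chi_neq0 s : (plucker c s != 0) = uniq s && basis M [set:: s].
Proof.
have [us|nu] := boolP (uniq s); last by rewrite plucker_nuniq // eqxx.
by rewrite plucker_uniq_eq0.
Qed.

(** The chirotope axiom is applied to [x :: c1 ++ c2] and [y :: c1 ++ z]; the separator leaves only
    the exchange of [x] and [y]. *)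
Lemma separator_GP_le c1 c2 z x y :
    all (mem X) (x :: y :: c1) -> all (mem (~: X)) z ->
    plucker c (x :: c1 ++ c2) != 0 ->
  0 <= plucker c (y :: c1 ++ c2) * plucker c (x :: c1 ++ z) ->
  0 <= plucker c (x :: c1 ++ c2) * plucker c (y :: c1 ++ z).
Proof.
move=> /and3P[xX yX c1X] zX n0 h.
have [_ _ _ _ h4] := chiP (repr M); rewrite -/c in h4.
apply: h4 => -[|i] /=; first by [].
rewrite ltnS => lti; set u := nth x _ i.
(* If [u] is in [c1], it is repeated. If it is in [z], it lies outside [X], and the basis
   [u :: c1 ++ c2] would meet [X] in fewer elements than [x :: c1 ++ c2]. *)
suff -> : plucker c (u :: c1 ++ c2) = 0 by rewrite mul0r.
apply: contraTeq n0; rewrite plucker_chi_neq0 => /andP[uu bu].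
apply/negP; rewrite plucker_chi_neq0 => /andP[ux bx].
have : u \in c1 ++ z by apply: mem_nth.
rewrite mem_cat => /orP[uc1|/(allP zX)].
  by move: uu; rewrite /= mem_cat uc1.
rewrite /= !inE => uX; have := separator_card sepX bu.
rewrite -(separator_card sepX bx) => e.
suff : [set:: u :: c1 ++ c2] :&: X \proper [set:: x :: c1 ++ c2] :&: X.
  by move/proper_card; rewrite e ltnn.
apply/properP; split.
  apply/subsetP=> t; rewrite !inE => /andP[/orP[/eqP->|->] tX].
    by case/negP: uX.
  by rewrite orbT.
exists x; rewrite !inE ?eqxx //; case/andP: ux => /negPf-> _; rewrite orbF.
by rewrite negb_and; apply/orP; left; apply: contraNneq uX => <-; apply: xX.
Qed.

(** All four values are 1 or -1. The inequality, used with [x] and [y] in both roles, makes one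
    product nonnegative exactly when the other is. *)
Lemma separator_GP c1 c2 z x y :
    all (mem X) (x :: y :: c1) -> all (mem (~: X)) z ->
    plucker c (x :: c1 ++ c2) != 0 -> plucker c (y :: c1 ++ c2) != 0 ->
    plucker c (x :: c1 ++ z) != 0 -> plucker c (y :: c1 ++ z) != 0 ->
  plucker c (x :: c1 ++ c2) * plucker c (y :: c1 ++ z) =
  plucker c (y :: c1 ++ c2) * plucker c (x :: c1 ++ z).
Proof.
move=> aX aZ nx ny nxz nyz.
have aX' : all (mem X) (y :: x :: c1) by move: aX; rewrite /= andbCA.
have h1 := separator_GP_le aX aZ nx; have h2 := separator_GP_le aX' aZ ny.
have [_ hv _ _ _] := chiP (repr M); rewrite -/c in hv.
have v s := plucker_val s hv.
move: nx ny nxz nyz h1 h2 (v (x :: c1 ++ c2)) (v (y :: c1 ++ c2))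
  (v (x :: c1 ++ z)) (v (y :: c1 ++ z)).
move: (plucker _ _) (plucker _ _) (plucker _ _) (plucker _ _) => a b d e.
move=> na nb nd ne h1 h2; rewrite !inE (negPf na) (negPf nb) (negPf nd) (negPf ne) /=.
move: h1 h2; clear.
move=> h1 h2 /orP[]/eqP ea /orP[]/eqP eb /orP[]/eqP ed /orP[]/eqP ee; subst;
  first [done | by have := h1 isT | by have := h2 isT].
Qed.

(** Up to a global sign, the restriction to [X] evaluates [c] with a fixed tail [z] outside [X] in
    place of [c2]. The sign ratio of an exchange inside [X] can therefore be read off from the
    restriction alone. *)
Lemma exchange_restrict B x y (c1 := enum ((B :\ y) :&: X))
    (c2 := enum ((B :\ y) :\: X)) (cX := chi (repr (restrict M X))) :
    basis M B -> basis M (x |: B :\ y) -> x \in X -> y \in X -> x \notin B -> y \in B ->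
  [/\ plucker cX (x :: c1) != 0, plucker cX (y :: c1) != 0 &
     plucker c (x :: c1 ++ c2) * plucker cX (y :: c1) =
     plucker c (y :: c1 ++ c2) * plucker cX (x :: c1)].
Proof.
move=> bB bB' xX yX xB yB; have sXg : X \subset ground M by case/andP: sepX.
pose z := enum (rank_basis M X :\: X).
have c1X : all (mem X) c1.
  by apply/allP=> t; rewrite mem_enum !inE => /andP[].
have zX : all (mem (~: X)) z.
  by apply/allP=> t; rewrite mem_enum !inE => /andP[].
have c2X : all (mem (~: X)) c2.
  by apply/allP=> t; rewrite mem_enum !inE => /andP[].
have uq t s : t \in X -> t \notin B :\ y -> all (mem (~: X)) s -> uniq s ->
    uniq (t :: c1 ++ s).
  move=> tX tB sX us; rewrite /= mem_cat negb_or cat_uniq enum_uniq us andbT /=.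
  rewrite mem_enum inE negb_and tB /=.
  have sX' v : v \in s -> v \notin X by move/(allP sX); rewrite /= inE.
  apply/andP; split; first by apply: contraL tX => /sX'.
  by apply/hasPn=> v /sX'; rewrite mem_enum inE negb_and => ->; rewrite orbT.
have xB' : x \notin B :\ y by rewrite inE negb_and xB orbT.
have yB' : y \notin B :\ y by rewrite !inE eqxx.
have e2 : [set:: c1 ++ c2] = B :\ y.
  by apply/setP=> t; rewrite inE mem_cat !mem_enum !inE;
      case: (t \in X); rewrite ?andbT ?orbF ?andbF.
have e3 D t : D = t |: B :\ y -> t \in X ->
    [set:: t :: c1 ++ z] = (D :&: X) :|: (rank_basis M X :\: X).
  move=> -> tX; apply/setP=> v; rewrite !inE mem_cat !mem_enum !inE.
  by case: (eqVneq v t) => [->|_] //=; rewrite tX.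
have eB : B = y |: B :\ y by rewrite setD1K.
have bz := (rank_basisP M X).1.
have n1 : plucker c (x :: c1 ++ c2) != 0.
  by rewrite plucker_chi_neq0 uq ?enum_uniq //= set_cons e2.
have n2 : plucker c (y :: c1 ++ c2) != 0.
  by rewrite plucker_chi_neq0 uq ?enum_uniq //= set_cons e2 -eB.
have n3 : plucker c (x :: c1 ++ z) != 0.
  by rewrite plucker_chi_neq0 uq ?enum_uniq //= (e3 _ _ erefl) // separator_swap.
have n4 : plucker c (y :: c1 ++ z) != 0.
  by rewrite plucker_chi_neq0 uq ?enum_uniq //= (e3 _ _ eB) // separator_swap.
have aX : all (mem X) [:: x, y & c1] by rewrite /= xX yX.
have := separator_GP aX zX n1 n2 n3 n4.
have cXE t : t \in X -> plucker (eslice c X z) (t :: c1) = plucker c (t :: c1 ++ z).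
  by move=> tX; rewrite plucker_eslice /= tX c1X.
case: (chi_restrict sXg); rewrite -/cX -/c -/z => ->; rewrite ?pluckerN !cXE //.
by rewrite !oppr_eq0 !mulrN => ->.
Qed.

End Exchange.

Section Determined.
Variables Q Q' : om T.
Hypothesis groundQ : ground Q = ground Q'.
Hypothesis componentsQ : components Q = components Q'.
Hypothesis restrictQ : forall X, X \in components Q -> restrict Q X = restrict Q' X.

(** A basis [B'] of [Q'] sharing the most elements with [B] is taken. Replacing its part in a
    component [X] by that of [B] cannot enlarge the overlap, so the two agree on [X]; the components
    cover the ground set. *)
Lemma basis_components B : basis Q B -> basis Q' B.
Proof.
move=> bB; have [B0 bB0] := ex_basis Q'.
case: (arg_maxnP (P := basis Q') (fun B' : {set T} => #|B :&: B'|) bB0) => B' bB' maxB'.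
suff -> : B = B' by [].
have eX X : X \in components Q -> B :&: X = B' :&: X.
  move=> cX; have [sX _] := component_separator cX.
  have [sX' _] : separator Q' X /\ X != set0.
    by apply: component_separator; rewrite -componentsQ.
  have b1 : basis (restrict Q' X) (B :&: X).
    by rewrite -restrictQ //; apply: basis_restrictP.
  have b2 := basis_restrictP sX' bB'.
  have := maxB' _ (basis_glue sX' b1 bB').
  rewrite -(cardsID X (B :&: B')) -(cardsID X (B :&: (_ :|: _))).
  have -> : B :&: ((B :&: X) :|: (B' :\: X)) :&: X = B :&: X.
    by apply/setP=> t; rewrite !inE; case: (t \in B); case: (t \in X); rewrite ?andbF.
  have -> : (B :&: ((B :&: X) :|: (B' :\: X))) :\: X = (B :&: B') :\: X.
    by apply/setP=> t; rewrite !inE; case: (t \in B); case: (t \in X); rewrite ?andbF.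
  rewrite /= leq_add2r => le.
  have e : (B :&: B') :&: X = B :&: X.
    by apply/eqP; rewrite eqEcard le andbT setSI // subsetIl.
  apply/eqP; rewrite eqEcard (basis_card b2 b1) leqnn andbT -e.
  by rewrite setSI // subsetIr.
apply/setP=> t; have [tg|ng] := boolP (t \in ground Q).
  have [X cX tX] := component_cover tg.
  by have /setP/(_ t) := eX _ cX; rewrite !inE tX !andbT.
have [tB|_] := boolP (t \in B); first by rewrite (subsetP (basis_sub bB)) in ng.
by apply/esym/negbTE; apply: contra ng; rewrite groundQ; apply/subsetP/basis_sub.
Qed.

End Determined.

(** The product of the two chirotopes is constant on bases: any basis is moved to [B0] by exchanges,
    each inside one component, where both chirotopes change by the same ratio. *)
Lemma chi_components Q Q' :
    ground Q = ground Q' -> components Q = components Q' ->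
    (forall X, X \in components Q -> restrict Q X = restrict Q' X) ->
  eqsgn (chi (repr Q)) (chi (repr Q')).
Proof.
move=> gQ cQ rQ; set c := chi (repr Q); set c' := chi (repr Q').
have bQ B : basis Q B = basis Q' B.
  apply/idP/idP; first exact: basis_components.
  by apply: basis_components => // X; rewrite -cQ => /rQ.
have [_ hv _ _ _] := chiP (repr Q); have [_ hv' _ _ _] := chiP (repr Q').
have sq (w : int) : w != 0 -> w \in [:: 0; 1; -1] -> w * w = 1.
  by move=> n; rewrite !inE (negPf n) /= => /orP[]/eqP->.
have [B0 b0] := ex_basis Q.
have key B : basis Q B -> c B * c' B = c B0 * c' B0.
  have [n] := ubnP #|B0 :\: B|; elim: n B => // n IHn B; rewrite ltnS => le_n bB.
  have [e0|[x]] := set_0Vmem (B0 :\: B).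
    suff -> : B0 = B by [].
    by apply/eqP; rewrite eqEcard (basis_card bB b0) leqnn andbT -setD_eq0 e0.
  rewrite inE => /andP[xB xB0]; have [y] := basis_exchange b0 bB xB0 xB.
  rewrite inE => /andP[yB0 yB] bB'.
  have {IHn} <- : c (x |: B :\ y) * c' (x |: B :\ y) = c B0 * c' B0.
    apply: IHn => //; apply: leq_trans le_n; rewrite [X in (_ < X)%N](cardsD1 x).
    rewrite inE xB xB0 /= ltnS; apply/subset_leq_card/subsetP=> t.
    rewrite !inE negb_or negb_and negbK => /andP[/andP[-> h] tB0].
    rewrite tB0 /= andbT; case/orP: h => // /eqP e; by rewrite -e tB0 in yB0.
  have [X cX xX] := component_cover (subsetP (basis_sub b0) x xB0).
  have [sX _] := component_separator cX.
  have [sX' _] : separator Q' X /\ X != set0.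
    by apply: component_separator; rewrite -cQ.
  (* Otherwise the exchange would change the number of basis elements in the separator [X]. *)
  have yX : y \in X.
    apply: contraT => yX; have := separator_card sX bB'.
    rewrite -(separator_card sX bB).
    have -> : (x |: B :\ y) :&: X = x |: (B :&: X).
      apply/setP=> t; rewrite !inE; case: (eqVneq t x) => [->|_] /=; first by rewrite xX.
      by case: (eqVneq t y) => [->|//]; rewrite (negPf yX) !andbF.
    by rewrite cardsU1 inE (negPf xB) add1n => /esym/n_Sn.
  have [n1 n2 e] := exchange_restrict sX bB bB' xX yX xB yB.
  have bB1 := bB; have bB1' := bB'; rewrite !bQ in bB1 bB1'.
  have [_ _ e'] := exchange_restrict sX' bB1 bB1' xX yX xB yB.
  rewrite -rQ // in e'; rewrite -/c in e; rewrite -/c' in e'.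
  set c1 := enum _ in e e' n1 n2; set c2 := enum _ in e e'.
  have [_ hvX _ _ _] := chiP (repr (restrict Q X)).
  have sx := sq _ n1 (plucker_val _ hvX); have sy := sq _ n2 (plucker_val _ hvX).
  have e2 : [set:: c1 ++ c2] = B :\ y.
    by apply/setP=> t; rewrite inE mem_cat !mem_enum !inE;
      case: (t \in X); rewrite ?andbT ?orbF ?andbF.
  have pE t : t \notin B :\ y ->
      plucker c (t :: c1 ++ c2) * plucker c' (t :: c1 ++ c2) =
      c (t |: B :\ y) * c' (t |: B :\ y).
    move=> tB; have ut : uniq (t :: c1 ++ c2).
      rewrite /= -[_ \in _]/(t \in c1 ++ c2).
      have -> : (t \in c1 ++ c2) = (t \in [set:: c1 ++ c2]) by rewrite inE.
      rewrite e2 tB cat_uniq !enum_uniq andbT /=.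
      by apply/hasPn=> v; rewrite !mem_enum !inE => /andP[/negPf->]; rewrite andbF.
    have [k pk] := plucker_sign ut; rewrite !pk set_cons e2 mulrACA -expr2 sqrr_sign.
    exact: mul1r.
  have xB' : x \notin B :\ y by rewrite inE negb_and xB orbT.
  have yB' : y \notin B :\ y by rewrite !inE eqxx.
  have -> : c B * c' B = c (y |: B :\ y) * c' (y |: B :\ y) by rewrite setD1K.
  rewrite -!pE //.
  (* Each side is multiplied by the square, equal to 1, of a value of the common restriction, so
     that the two ratio equations apply. *)
  rewrite -[LHS]mulr1 -sx -[RHS]mulr1 -sy mulrACA -e -e'.
  exact: mulrACA.
have nz B : ~~ basis Q B -> c B = 0 /\ c' B = 0.
  by move=> nB; split; apply/eqP; apply: contraNT nB => //; rewrite bQ.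
have b0' : basis Q' B0 by rewrite -bQ.
have s0 := sq _ b0 (hv B0); have s0' := sq _ b0' (hv' B0).
have {}key B : c B = (c B0 * c' B0) * c' B.
  have [bB|/nz[-> ->]] := boolP (basis Q B); last by rewrite mulr0.
  have bB' : basis Q' B by rewrite -bQ.
  by rewrite -(key _ bB) -mulrA (sq _ bB' (hv' B)) mulr1.
have : c B0 * c' B0 \in [:: 0; 1; -1].
  have := hv B0; have := hv' B0; rewrite !inE -/c -/c'.
  by case/or3P=> /eqP-> /or3P[] /eqP->.
rewrite !inE => /or3P[] /eqP e.
- by move/eqP: e; rewrite mulf_eq0 (negPf b0) (negPf b0').
- by left; apply/ffunP=> B; rewrite key e mul1r.
- by right; apply/ffunP=> B; rewrite key e mulN1r ffunE.
Qed.

End Components.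



(** * Monomials determine chirotopes up to sign *)

Section Monomials.
Import finmap.
Variables (T : finType) (P : {set T}).
Implicit Types (M Q : om T) (X : {set T}).

(** The exponent of [q] counts the components on which [M] restricts to [val q]. *)
Lemma om_monom_neq0 M (q : om_var P) : ground M \subset P ->
  reflect (exists2 X, X \in components M & restrict M X = val q)
          (om_monom P M q != 0%N).
Proof.
move=> sMP.
have -> : om_monom P M q = (\sum_(X in components M) (restrict M X == val q))%N.
  rewrite /om_monom (big_morph (fun m : {cmonom om_var P} => m q) (id1 := 0%N) (op1 := addn)).
  - apply: eq_bigr => X cX; have [q' <- ->] := component_varP sMP cX.
    by rewrite cmU (inj_eq val_inj).
  - by move=> m1 m2; rewrite cmM.
  - by rewrite cm1.
rewrite sum_nat_eq0; apply: (iffP forall_inPn) => [[X cX]|[X cX e]].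
  by rewrite eqb0 negbK => /eqP; exists X.
by exists X => //; rewrite e eqxx.
Qed.

(** A component is recovered from its variable as the ground set of the restriction. *)
Lemma om_monom_components M Q : ground M \subset P -> ground Q \subset P ->
    om_monom P M = om_monom P Q ->
  forall X, X \in components M -> X \in components Q /\ restrict M X = restrict Q X.
Proof.
move=> sM sQ e X cX; have [q vq _] := component_varP sM cX.
have : om_monom P M q != 0%N by apply/om_monom_neq0 => //; exists X.
rewrite e => /om_monom_neq0[//|Y cY eY]; rewrite -vq -eY.
suff -> : X = Y by [].
have [/andP[sX _] _] := component_separator cX.
have [/andP[sY _] _] := component_separator cY.
by rewrite -(ground_restrict sX) -(ground_restrict sY) eY vq.
Qed.

Lemma om_monom_chi M Q : ground M = P -> ground Q = P ->
  om_monom P M = om_monom P Q -> eqsgn (chi (repr M)) (chi (repr Q)).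
Proof.
move=> gM gQ e.
have sM : ground M \subset P by rewrite gM.
have sQ : ground Q \subset P by rewrite gQ.
have h1 := om_monom_components sM sQ e.
have h2 := om_monom_components sQ sM (esym e).
apply: chi_components => [||X /h1[]//]; first by rewrite gM.
by apply/setP=> X; apply/idP/idP=> [/h1[]|/h2[]].
Qed.

End Monomials.

(** * The replacement of monomials is well defined *)

Section Replace.
Variables (F : realType) (K L : fieldType).
Variables (inc : {rmorphism K -> F}) (f : {rmorphism K -> L}) (T : finType).
Variables (eps : seq T -> int) (g r : T -> L) (P E : seq T).
Implicit Types N : exterior K T.

Lemma ehomN (h : T -> exterior L (doubled T)) N : ehom f h (- N) = - ehom f h N.
Proof.
rewrite /ehom -sumrN; apply: eq_bigr => A _.
by rewrite ffunE rmorphN scaleNr.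
Qed.

Lemma dualN (S : {set T}) N : dual eps S (- N) = - dual eps S N.
Proof.
by apply/ffunP=> A; rewrite !ffunE pluckerN mulNr; case: ifP; rewrite ?oppr0.
Qed.

Lemma port_extensorN N :
  port_extensor f eps g r P E (- N) = port_extensor f eps g r P E N.
Proof.
by rewrite /port_extensor /ME /= /Mext /iota_g /upsilon_r dualN !ehomN mulrNN.
Qed.

(** The presentation picked by [xget] may belong to another oriented matroid with the same monomial.
    Its chirotope agrees up to sign, hence so does its unimodular extensor, and [port_extensor] does
    not see the sign. *)
Lemma replace_monomE N (Q : om T) :
    unimodular_presentation inc [set:: P] N Q ->
  replace_monom inc f eps g r E (om_monom [set:: P] Q) = port_extensor f eps g r P E N.
Proof.
move=> prN; rewrite /replace_monom.
case: classical_sets.xgetP => [N' _ [Q' prN' e]|/(_ N)]; last first.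
  by case; exists Q.
have [[_ _ gQ chiQ] uN] := prN; have [[_ _ gQ' chiQ'] uN'] := prN'.
have : eqsgn (sign_ext inc N') (sign_ext inc N).
  apply: eqsgn_trans (eqsgn_sym chiQ') _; apply: eqsgn_trans chiQ.
  exact: om_monom_chi e.
by case/(eqsgn_sign_ext uN' uN) => ->; rewrite ?port_extensorN.
Qed.

End Replace.

(** * Additivity of the substitution *)

Section Subst.
Variables (L : fieldType) (T : finType) (P : {set T}) (V : lmodType L).
Variable h : {cmonom om_var P} -> V.

(** Zero coefficients contribute nothing; a larger index set allows two polynomials to be summed
    over a common one. *)
Lemma subst_uv0E (R : Rring L P) d : finmap.fsubset (msupp R) d ->
  subst_uv0 h R = \sum_(m <- finmap.enum_fset d) (R@_m).[0].[0] *: h m.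
Proof.
move=> sd; rewrite /subst_uv0; apply: finmap.big_fset_incl sd _ => m _ /mcoeff_outdom ->.
by rewrite !horner0 scale0r.
Qed.

Lemma subst_uv0D : {morph subst_uv0 h : R1 R2 / R1 + R2}.
Proof.
move=> R1 R2; rewrite (subst_uv0E (msuppD_le R1 R2)).
rewrite (subst_uv0E (finmap.fsubsetUl (msupp R1) (msupp R2))).
rewrite (subst_uv0E (finmap.fsubsetUr (msupp R1) (msupp R2))) -big_split.
by apply: eq_bigr => m _; rewrite mcoeffD !hornerD scalerDl.
Qed.

Lemma subst_uv0_0 : subst_uv0 h 0 = 0.
Proof. by rewrite /subst_uv0 msupp0 finmap.big_seq_fset0. Qed.

Lemma subst_uv0U c m : subst_uv0 h (<< c *g m >> : Rring L P) = c.[0].[0] *: h m.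
Proof. by rewrite (subst_uv0E msuppU_le) finmap.big_seq_fset1 mcoeffUU. Qed.

End Subst.



(** * Expansion of the product *)

Section Contraction.
Variables (K : fieldType) (T : finType).
Implicit Types (x : exterior K T) (z s : seq T).

Lemma free_of_eseq e s : e \notin s -> free_of e (eseq K s).
Proof.
move=> es B eB; rewrite eseqE !ffunE; case: eqP => [eBs|_]; last exact: mulr0.
by move: eB; rewrite eBs inE (negPf es).
Qed.

Lemma econtract_free e x z : e \in z -> free_of e x -> econtract x z = 0.
Proof.
move=> ez fx; apply/ffunP=> B; rewrite econtractE /plucker fx ?mulr0 ?ffunE //.
by rewrite inE mem_cat ez orbT.
Qed.

Lemma econtract_mul x z : uniq z -> {in z, forall e, free_of e x} ->
  econtract (x * eseq K z) z = x.
Proof.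
elim: z x => [|e z IHz] x /=; first by rewrite /eseq big_nil mulr1.
case/andP=> ez uz fx; rewrite eseq_cons mulrA IHz // => [|u uz'].
  by apply: econtract1_mul; apply: fx; apply: mem_head.
apply: free_of_mul; first by apply: fx; rewrite inE uz' orbT.
rewrite -[evec K e](big_seq1 *%R); apply: free_of_eseq.
by rewrite inE; apply: contraNneq ez => <-.
Qed.

End Contraction.

Lemma sum_powersetU (T : finType) (V : nmodType) (P E : {set T}) (G : {set T} -> V) :
  [disjoint P & E] ->
  \sum_(B in powerset (P :|: E)) G B =
  \sum_(A in powerset E) \sum_(C in powerset P) G (C :|: A).
Proof.
move=> dPE; have PE t : t \in P -> t \in E -> False.
  by move=> tP tE; move/pred0P/(_ t): dPE; rewrite /= tP tE.
rewrite (partition_big (fun B => B :&: E) (mem (powerset E))) /=; last first.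
  by move=> B _; rewrite inE subsetIr.
apply: eq_bigr => A; rewrite inE => sA.
rewrite (reindex_onto (fun C => C :|: A) (fun B => B :&: P)) /=; last first.
  move=> B /andP[]; rewrite inE => sB /eqP <-; rewrite -setIUr.
  exact/setIidPl.
apply: eq_bigl => C; rewrite !inE; apply/andP/idP => [[/andP[_ _] /eqP <-]|sC].
  exact: subsetIr.
have CE : C :&: E = set0.
  apply/setP=> t; rewrite !inE; apply/negP=> /andP[/(subsetP sC) tP tE].
  exact: PE tP tE.
have AP : A :&: P = set0.
  apply/setP=> t; rewrite !inE; apply/negP=> /andP[/(subsetP sA) tE tP].
  exact: PE tP tE.
by rewrite setUSS // !setIUl CE AP set0U setU0 (setIidPl sA) (setIidPl sC) !eqxx.
Qed.

Lemma perm_enum_setU (T : finType) (A B : {set T}) : [disjoint A & B] ->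
  perm_eq (enum (A :|: B)) (enum A ++ enum B).
Proof.
move=> dAB; apply: uniq_perm; first exact: enum_uniq.
  rewrite cat_uniq !enum_uniq andbT /=; apply/hasPn=> t; rewrite !mem_enum => tB.
  by apply/negP=> tA; move/pred0P/(_ t): dAB; rewrite /= tA tB.
by move=> t; rewrite mem_cat !mem_enum inE.
Qed.

(** * Expansion of the two homomorphisms with ports listed first *)

Section Hom.
Variables (K L : fieldType) (f : {rmorphism K -> L}) (T : finType).
Implicit Types (N : exterior K T) (a : T -> L) (s : seq T).

Section Expand.
Variables (U : finType) (h : T -> exterior L U).
Hypothesis hC : forall t u, h t * h u = - (h u * h t).

(** Coordinate and product both change sign under an adjacent swap. *)
Lemma hom_term_perm N s s' : perm_eq s s' ->
  f (plucker N s) *: \prod_(t <- s) h t = f (plucker N s') *: \prod_(t <- s') h t.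
Proof.
apply: (perm_swap_inv (F := fun s => f (plucker N s) *: \prod_(t <- s) h t)).
move=> a x y b _; rewrite plucker_swap rmorphN scaleNr -scalerN; congr (_ *: _).
by rewrite !big_cat !big_cons /= !(mulrA (h _)) hC mulNr mulrN opprK.
Qed.

Lemma ehomE N (P E : {set T}) : [disjoint P & E] ->
    (forall B, N B != 0 -> B \subset P :|: E) ->
  ehom f h N = \sum_(A in powerset E) \sum_(C in powerset P)
    f (plucker N (enum C ++ enum A)) *:
      (\prod_(t <- enum C) h t * \prod_(t <- enum A) h t).
Proof.
move=> dPE sN; transitivity (\sum_(B in powerset (P :|: E))
    f (N B) *: \prod_(t <- enum B) h t).
  rewrite [RHS]big_mkcond; apply: eq_bigr => B _; rewrite inE.
  case: ifP => // nB; have [->|/sN] := eqVneq (N B) 0; first by rewrite rmorph0 scale0r.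
  by rewrite nB.
rewrite sum_powersetU //; apply: eq_bigr => A; rewrite inE => sA.
apply: eq_bigr => C; rewrite inE => sC; rewrite -big_cat -plucker_enum.
apply/hom_term_perm/perm_enum_setU.
by apply: disjointWl sC _; apply: disjointWr sA _.
Qed.

End Expand.

Section Ports.
Variables (P E : seq T) (j : T -> doubled T) (a : T -> L).
Let h t := if t \in P then evec L (j t) else a t *: evec L (elt t).

Lemma port_homC t u : h t * h u = - (h u * h t).
Proof.
rewrite /h; case: ifP => _; case: ifP => _; rewrite -?wedgeZl -?wedgeZr -?wedgeZl.
- exact: evecC.
- by rewrite evecC scalerN.
- by rewrite evecC scalerN.
- by rewrite evecC !scalerN !scalerA mulrC.
Qed.

Lemma prod_ports s : {subset s <= P} -> \prod_(t <- s) h t = eseq L (map j s).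
Proof.
move=> sP; rewrite /eseq big_map; apply: eq_big_seq => t /sP.
by rewrite /h => ->.
Qed.

Lemma prod_elts s : {in s, forall t, t \notin P} ->
  \prod_(t <- s) h t = (\prod_(t <- s) a t) *: eseq L (map (@elt T) s).
Proof.
elim: s => [|t s IHs] nP; first by rewrite /eseq !big_nil scale1r.
rewrite !big_cons IHs => [|u us]; last by apply: nP; rewrite inE us orbT.
rewrite /h (negPf (nP t (mem_head _ _))) eseq_cons -wedgeZl -wedgeZr scalerA.
by rewrite mulrC.
Qed.

Lemma ported_ehomE N : uniq (P ++ E) ->
    (forall B, N B != 0 -> B \subset [set:: P ++ E]) ->
  ehom f h N = \sum_(A in powerset [set:: E]) (\prod_(e in A) a e) *:
    \sum_(C in powerset [set:: P]) f (plucker N (enum C ++ enum A)) *: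
      eseq L (map j (enum C) ++ map (@elt T) (enum A)).
Proof.
rewrite cat_uniq => /and3P[_ /hasPn nPE _] sN.
rewrite (@ehomE _ h port_homC N [set:: P] [set:: E]).
- apply: eq_bigr => A; rewrite inE => sA; rewrite scaler_sumr.
  apply: eq_bigr => C; rewrite inE => sC.
  rewrite prod_ports => [|t]; last first.
    by rewrite mem_enum => /(subsetP sC); rewrite inE.
  rewrite prod_elts => [|t]; last first.
    by rewrite mem_enum => /(subsetP sA); rewrite inE => /nPE.
  rewrite -wedgeZr !scalerA mulrC eseq_cat.
  by rewrite big_enum.
- rewrite disjoint_sym disjoint_subset; apply/subsetP=> t; rewrite !inE.
  exact: nPE.
- suff -> : [set:: P] :|: [set:: E] = [set:: P ++ E] by [].
  by apply/setP=> t; rewrite !inE mem_cat.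
Qed.

Lemma port_ehomE N : (forall B, N B != 0 -> B \subset [set:: P]) ->
  ehom f h N = \sum_(C in powerset [set:: P]) f (N C) *: eseq L (map j (enum C)).
Proof.
move=> sN; rewrite /ehom [RHS]big_mkcond; apply: eq_bigr => C _; rewrite inE.
case: ifP => [sC|nC].
  rewrite prod_ports // => t.
  by rewrite mem_enum => /(subsetP sC); rewrite inE.
have [->|/sN] := eqVneq (N C) 0; first by rewrite rmorph0 scale0r.
by rewrite nC.
Qed.

End Ports.
End Hom.



Lemma perm_enum_setD (T : finType) (E : seq T) (A : {set T}) :
  uniq E -> A \subset [set:: E] ->
  perm_eq (enum A ++ enum ([set:: E] :\: A)) E.
Proof.
move=> uE sA; rewrite perm_sym; apply: (perm_trans (y := enum [set:: E])).
  by apply: uniq_perm => // [|t]; rewrite ?enum_uniq // mem_enum inE.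
by rewrite -{1}(setUDK sA); apply: perm_enum_setU; apply: disjointsD.
Qed.

(** * Ground set orientations and reordering *)

Section Orientation.
Variables (T : finType) (S : {set T}) (eps : seq T -> int).
Hypothesis orS : orientation S eps.

Lemma orientation_sq s : {subset s <= S} -> uniq s -> eps s * eps s = 1.
Proof. by case: orS => _ h _ _ sS us; case: (h s sS us) => ->. Qed.

Lemma orientation_swap a t u b : {subset a ++ t :: u :: b <= S} ->
  eps (a ++ t :: u :: b) = - eps (a ++ u :: t :: b).
Proof. by case: orS => _ _ _ h; apply: (h a [::] b). Qed.

(** Two alternating functions multiply to a symmetric one. Values in a module cover both scalar
    coordinates and exterior products. *)
Lemma orientation_perm (R : pzRingType) (V : lmodType R) (phi : seq T -> V) pre post s s' :
    {subset pre ++ s ++ post <= S} ->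
    (forall a t u b, perm_eq (a ++ t :: u :: b) s ->
       phi (a ++ t :: u :: b) = - phi (a ++ u :: t :: b)) ->
  perm_eq s s' ->
  (eps (pre ++ s ++ post))%:~R *: phi s = (eps (pre ++ s' ++ post))%:~R *: phi s'.
Proof.
move=> sS alt; apply: (perm_swap_inv
  (F := fun s => (eps (pre ++ s ++ post))%:~R *: phi s)) => a t u b pab.
rewrite alt // -catA !cat_cons catA orientation_swap -?catA => [|v].
  by rewrite rmorphN scaleNr scalerN opprK.
by move=> hv; apply: sS; move: hv; rewrite !mem_cat -(perm_mem pab) !(mem_cat, inE) !orbA.
Qed.

(** The product [eps (s ++ E) * eps s] is symmetric in [s], so it can be evaluated at [P]; then
    [eps s] squares to 1. *)
Lemma orientation_cat_sq P E : {subset P ++ E <= S} -> uniq (P ++ E) ->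
  forall s, perm_eq s P -> eps (s ++ E) = eps P * eps (P ++ E) * eps s.
Proof.
move=> sS uPE s ps.
have sP : {subset P <= S} by move=> t tP; apply: sS; rewrite mem_cat tP.
have ss : {subset s <= S} by move=> t; rewrite (perm_mem ps); apply: sP.
have us : uniq s.
  by rewrite (perm_uniq ps); move: uPE; rewrite cat_uniq => /andP[].
have e : eps (s ++ E) * eps s = eps (P ++ E) * eps P.
  rewrite -[eps (s ++ E)]intz -[eps (P ++ E)]intz.
  apply: (@orientation_perm int int^o eps [::] E s P) => //.
    by move=> t; rewrite /= mem_cat (perm_mem ps) -mem_cat; apply: sS.
  by move=> a t u b pa; apply: orientation_swap => v; rewrite (perm_mem pa); apply: ss.
by rewrite -[LHS]mulr1 -(orientation_sq ss us) mulrA e (mulrC (eps P)).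
Qed.

(** The definition of [dual] fixes one order of each set. The formula is carried to all orders by
    rearranging first [x], then [y], each time together with [eps]. *)
Lemma dual_plucker (K : fieldType) (N : exterior K T) x y :
    {subset y ++ x <= S} -> {subset S <= y ++ x} -> uniq (y ++ x) ->
  plucker (dual eps S N) x = plucker N y * (eps (y ++ x))%:~R.
Proof.
move=> sS Ss uyx; have := uyx; rewrite cat_uniq => /and3P[uy /hasPn nyx ux].
have pe (s : seq T) : uniq s -> perm_eq s (enum [set:: s]).
  by move=> us; apply: uniq_perm; rewrite ?enum_uniq // => t; rewrite mem_enum inE.
have eS : S :\: [set:: x] = [set:: y].
  apply/setP=> t; rewrite !inE; apply/andP/idP=> [[nx /Ss]|ty].
    by rewrite mem_cat (negPf nx) orbF.
  split; last by apply: sS; rewrite mem_cat ty.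
  by apply/negP=> /nyx; rewrite ty.
have sxS : [set:: x] \subset S.
  by apply/subsetP=> t; rewrite inE => tx; apply: sS; rewrite mem_cat tx orbT.
set X := enum [set:: x]; set Y := enum [set:: y].
have uX : uniq (y ++ X).
  rewrite cat_uniq uy enum_uniq andbT /=; apply/hasPn=> t.
  by rewrite mem_enum inE => /nyx.
have sX : {subset y ++ X <= S}.
  by move=> t; rewrite mem_cat mem_enum inE -mem_cat; apply: sS.
have e1 : (eps (y ++ x))%:~R * plucker (dual eps S N) x =
    (eps (y ++ X))%:~R * plucker (dual eps S N) X.
  have := @orientation_perm K K^o (plucker (dual eps S N)) y [::] x X.
  rewrite !cats0; apply=> //.
  - by move=> a t u b _; apply: plucker_swap.
  - exact: pe.
have e2 : (eps (y ++ X))%:~R * plucker N y = (eps (Y ++ X))%:~R * plucker N Y.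
  apply: (@orientation_perm K K^o (plucker N) [::] X y Y) => //.
  - by move=> a t u b _; apply: plucker_swap.
  - exact: pe.
have sq s : {subset s <= S} -> uniq s -> (eps s)%:~R * (eps s)%:~R = 1 :> K.
  by move=> sS' us; rewrite -rmorphM orientation_sq.
have e3 : plucker (dual eps S N) X = plucker N Y * (eps (Y ++ X))%:~R.
  by rewrite plucker_enum ffunE sxS eS plucker_enum.
rewrite e3 (mulrC (plucker N Y)) -e2 mulrA sq // mul1r in e1.
by rewrite -e1 mulrAC sq // mul1r.
Qed.

End Orientation.



Lemma port_extensor0 (K L : fieldType) (f : {rmorphism K -> L}) (T : finType)
    (eps : seq T -> int) (g r : T -> L) (P E : seq T) :
  port_extensor f eps g r P E 0 = 0.
Proof.
rewrite /port_extensor /ME /= /Mext [iota_g _ _ _ _]big1 ?mul0r ?scaler0 // => A _.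
by rewrite ffunE rmorph0 scale0r.
Qed.

(** * Surviving terms of the contracted product and their signs *)

Section Expansion.
Variables (K L : fieldType) (f : {rmorphism K -> L}) (T : finType).
Variables (P E : seq T) (g r : T -> L) (eps : seq T -> int).
Hypothesis uPE : uniq (P ++ E).
Hypothesis orE : orientation [set:: P ++ E] eps.
Local Notation S := [set:: P ++ E].
Implicit Types (A C D : {set T}) (N : exterior K T).

Let iota_mon C A := eseq L (map (@port_iota T) (enum C) ++ map (@elt T) (enum A)).
Let upsilon_mon D A := eseq L (map (@port_upsilon T) (enum D) ++ map (@elt T) (enum A)).

Let uE : uniq E. Proof. by move: uPE; rewrite cat_uniq => /and3P[]. Qed.
Let uP : uniq P. Proof. by move: uPE; rewrite cat_uniq => /and3P[]. Qed.
Let nEP t : t \in E -> t \notin P.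
Proof. by move: uPE; rewrite cat_uniq => /and3P[_ /hasPn h _] /h. Qed.

(** Either [A] and [A'] share an element, which repeats a factor, or some element of [E] is in
    neither and contracting it gives zero. *)
Lemma econtract_mon0 A A' C D : A \subset [set:: E] -> A' \subset [set:: E] ->
    A' != [set:: E] :\: A ->
  econtract (iota_mon C A * upsilon_mon D A') (map (@elt T) E) = 0.
Proof.
move=> sA sA' nA'; rewrite -eseq_cat; set s := _ ++ _.
have inj : injective (@elt T) by move=> t u [].
have [|[t]] := set_0Vmem (([set:: E] :\: A) :\: A').
  move/eqP; rewrite setD_eq0 => sDA.
  have [t tA' tA] : exists2 t, t \in A' & t \in A.
    apply/exists_inP; apply: contraT => /exists_inPn h; case/negP: nA'.
    rewrite eqEsubset sDA andbT; apply/subsetP=> t tA'.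
    by rewrite inE h // (subsetP sA').
  have -> : eseq L s = 0; last by rewrite econtract0.
  apply: eseq_nuniq; rewrite /s -catA !cat_uniq.
  apply/negP=> /and3P[_ _ /andP[_ /andP[/hasPn/(_ (elt t)) h _]]].
  move: h; rewrite mem_cat !mem_map // !mem_enum tA tA' orbT.
  by move/(_ isT).
rewrite !inE => /and3P[tA' tA tE].
apply: (econtract_free (e := elt t)); first by rewrite mem_map.
apply: free_of_eseq; rewrite /s !mem_cat !mem_map // !mem_enum (negPf tA) (negPf tA').
by rewrite !orbF; apply/norP; split; apply/mapP=> -[].
Qed.

(** [enum A] is moved past [enum D] in the orientation and in the exterior product at once, so no
    sign appears. Then [E] stands last and is contracted away, and [orientation_cat_sq] splits off
    the constant factor. *)
Lemma econtract_mon A C D : A \subset [set:: E] -> D \subset [set:: P] ->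
  (eps (enum ([set:: P] :\: D) ++ enum A ++ enum D ++ enum ([set:: E] :\: A)))%:~R *:
    econtract (iota_mon C A * upsilon_mon D ([set:: E] :\: A)) (map (@elt T) E) =
  (eps P * eps (P ++ E) * eps (enum ([set:: P] :\: D) ++ enum D))%:~R *:
    eseq L (map (@port_iota T) (enum C) ++ map (@port_upsilon T) (enum D)).
Proof.
move=> sA sD; set Dc := enum (_ :\: D); set A' := _ :\: A.
(* One map serves ports and elements, so that the rearranged part is the image of a single sequence
   in [T]. *)
pose j t := if t \in P then port_upsilon t else elt t.
have jP (B : {set T}) : B \subset [set:: P] -> map j (enum B) = map (@port_upsilon T) (enum B).
  move=> sB; apply/eq_in_map => t; rewrite mem_enum => /(subsetP sB).
  by rewrite inE /j => ->.
have jE (s : seq T) : {subset s <= E} -> map j s = map (@elt T) s.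
  by move=> sE; apply/eq_in_map => t /sE/nEP; rewrite /j => /negPf->.
have eE (B : {set T}) : B \subset [set:: E] -> {subset enum B <= E}.
  by move=> sB t; rewrite mem_enum => /(subsetP sB); rewrite inE.
have pD : perm_eq (Dc ++ enum D) P.
  by rewrite perm_catC; apply: perm_enum_setD.
have pA : perm_eq (enum A ++ enum A') E by apply: perm_enum_setD.
have ps : perm_eq (enum A ++ enum D ++ enum A') (enum D ++ E).
  by rewrite perm_catCA perm_cat2l.
have sS : {subset P ++ E <= S} by move=> t; rewrite inE.
have := @orientation_perm _ _ _ orE L _ (fun s => eseq L (map (@port_iota T) (enum C) ++ map j s))
  Dc [::] _ _ _ _ ps.
rewrite !cats0 -econtractZ => H.
have -> : iota_mon C A * upsilon_mon D A' =
    eseq L (map (@port_iota T) (enum C) ++ map j (enum A ++ enum D ++ enum A')).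
  rewrite -eseq_cat -!catA !map_cat (jP D) // !jE //; apply: eE => //; exact: subsetDl.
rewrite H => [|t|a t u b _]; first last.
- by rewrite !map_cat !catA /= eseq_swap.
- move=> ht; apply: sS; move: ht; rewrite mem_cat (perm_mem ps) mem_cat orbA -mem_cat.
  by rewrite (mem_cat t P) (perm_mem pD).
rewrite econtractZ catA (orientation_cat_sq orE sS uPE pD); congr (_ *: _).
rewrite map_cat (jP D) // jE // catA eseq_cat econtract_mul // => [|e /mapP[t _ ->]].
  by rewrite map_inj_uniq // => t u [].
by apply: free_of_eseq; rewrite mem_cat; apply/norP; split; apply/mapP=> -[].
Qed.

Lemma ME_expand N : (forall B, N B != 0 -> B \subset S) ->
  ME f eps g r P E N = \sum_(A in powerset [set:: E])
    ((\prod_(e in A) g e) * (\prod_(e in [set:: E] :\: A) r e)) *: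
    port_extensor f eps g r P E (eslice N [set:: P] (enum A)).
Proof.
move=> sN; rewrite /ME /Mext /iota_g /upsilon_r.
have sD B : dual eps S N B != 0 -> B \subset S by rewrite ffunE; case: ifP => //; rewrite eqxx.
rewrite !(ported_ehomE _ _ _ uPE) // big_distrlr /= econtract_sum.
apply: eq_bigr => A; rewrite inE => sA; rewrite econtract_sum.
pose a C A' D := f (plucker N (enum C ++ enum A)) * f (plucker (dual eps S N) (enum D ++ enum A')).
have tE A' : econtract
    (((\prod_(e in A) g e) *: \sum_(C in powerset [set:: P])
         f (plucker N (enum C ++ enum A)) *: iota_mon C A) *
     ((\prod_(e in A') r e) *: \sum_(D in powerset [set:: P])
         f (plucker (dual eps S N) (enum D ++ enum A')) *: upsilon_mon D A'))
    (map (@elt T) E) =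
  ((\prod_(e in A) g e) * (\prod_(e in A') r e)) *:
    \sum_(C in powerset [set:: P]) \sum_(D in powerset [set:: P])
      a C A' D *: econtract (iota_mon C A * upsilon_mon D A') (map (@elt T) E).
  rewrite -wedgeZl -wedgeZr scalerA econtractZ big_distrlr econtract_sum.
  congr (_ *: _); apply: eq_bigr => C _; rewrite econtract_sum.
  by apply: eq_bigr => D _; rewrite /= -wedgeZl -wedgeZr scalerA econtractZ.
(* Only the complement of [A] in [E] survives the contraction. *)
rewrite (bigD1 ([set:: E] :\: A)) /=; last by rewrite inE subsetDl.
rewrite [X in _ + X]big1 ?addr0 => [|A' /andP[]]; last first.
  rewrite inE => sA' nA'; rewrite tE [X in _ *: X]big1 ?scaler0 // => C _.
  by rewrite big1 // => D _; rewrite econtract_mon0 ?scaler0.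
rewrite tE; congr (_ *: _); rewrite /port_extensor /ME /= /Mext /iota_g /upsilon_r cats0.
have sL B : eslice N [set:: P] (enum A) B != 0 -> B \subset [set:: P].
  by rewrite ffunE; case: ifP => //; rewrite eqxx.
have sDL B : dual eps [set:: P] (eslice N [set:: P] (enum A)) B != 0 -> B \subset [set:: P].
  by rewrite ffunE; case: ifP => //; rewrite eqxx.
rewrite !port_ehomE // big_distrlr scaler_sumr; apply: eq_bigr => C; rewrite inE => sC.
rewrite scaler_sumr; apply: eq_bigr => D; rewrite inE /= => sDP.
rewrite -wedgeZl -wedgeZr !scalerA -eseq_cat !ffunE sC sDP.
have all_DP : all (mem [set:: P]) (enum ([set:: P] :\: D)).
  by apply/allP=> t; rewrite mem_enum !inE => /andP[].
(* This arrangement of the ground set turns the dual coordinate at [D] and [[set:: E] :\: A] into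
   the coordinate of [N] at [[set:: P] :\: D] and [A], which is one of the slice by [A]. *)
have pS : perm_eq ((enum ([set:: P] :\: D) ++ enum A) ++
    enum D ++ enum ([set:: E] :\: A)) (P ++ E).
  rewrite perm_catACA; apply: perm_cat; last exact: perm_enum_setD.
  by rewrite perm_catC perm_enum_setD.
rewrite plucker_eslice all_DP /a (@dual_plucker _ _ _ orE _ N _ (enum ([set:: P] :\: D) ++ enum A)).
- rewrite -catA ![f (_ * (eps _)%:~R)]rmorphM !rmorph_int mulrA -scalerA econtract_mon // scalerA.
  congr (_ *: _); rewrite !intrM [LHS]mulrCA; congr (_ * _).
  exact/esym/mulrA.
- by move=> t; rewrite (perm_mem pS) inE.
- by move=> t; rewrite (perm_mem pS) inE.
- by rewrite (perm_uniq pS).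
Qed.

End Expansion.

(** * Comparison of the expansion with the polynomial, term by term in [A] *)

Theorem theorem27 (F : realType) (K L : fieldType) (inc : {rmorphism K -> F})
    (f : {rmorphism K -> L}) (T : finType) (P E : seq T) (g r : T -> L)
    (eps : seq T -> int) (M : om T) (N : exterior K T) :
  uniq (P ++ E) ->
  orientation [set:: P ++ E] eps ->
  unimodular_presentation inc [set:: P ++ E] N M ->
  (forall A : {set T}, A \subset [set:: E] ->
     (exists LA : exterior K T,
        unimodular_presentation inc [set:: P] LA (minor M E A)) /\
     (forall LA : exterior K T,
        unimodular_presentation inc [set:: P] LA (minor M E A) ->
        replace_monom inc f eps g r E (om_monom [set:: P] (minor M E A)) =
          (eps P * eps (P ++ E))%:~R *: ME f eps g r P [::] LA)) /\
  ME f eps g r P E N =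
    subst_uv0 (replace_monom inc f eps g r E) (Rpoly g r P E M).
Proof.
move=> uPE orE prN; have [[_ _ gM chiM] _] := prN.
have gE : ground M :\: [set:: E] = [set:: P].
  rewrite gM; apply/setP=> t; rewrite !inE mem_cat.
  move: uPE; rewrite cat_uniq => /and3P[_ /hasPn h _].
  by have [/h/negPf->|] := boolP (t \in E); rewrite ?orbF.
split=> [A sA|].
  split; last by move=> LA; apply: replace_monomE.
  have [Z1 [Z2 [_ _ c _]]] := minor_chi M sA; rewrite gE in c.
  exists (eslice N [set:: P] (enum Z2 ++ enum Z1)).
  by apply: unimodular_presentation_eslice prN _ c; rewrite ground_minor.
have sN B : N B != 0 -> basis M B.
  by rewrite /basis (eqsgn_neq0 _ chiM) sign_ext_eq0.
rewrite ME_expand // => [|B /sN /basis_sub]; last by rewrite gM.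
rewrite /Rpoly (big_morph _ (subst_uv0D _) (subst_uv0_0 _)).
apply: eq_bigr => A; rewrite inE => sA; rewrite subst_uv0U.
have [Z1 [Z2 [[sZ1 cZ1] rk c spanning]]] := minor_chi M sA; rewrite gE in c spanning.
have eZ : (#|A| - rank M A)%N = #|A :\: Z1| by rewrite -cZ1 cardsDS.
rewrite rk eZ !hornerE.
(* A power of zero is 1 exactly when its exponent vanishes, so the term survives only for [Z2] empty
   and [Z1 = A]. *)
rewrite !expr0n !cards_eq0 setD_eq0.
have eA : (A \subset Z1) = (Z1 == A) by rewrite eqEsubset sZ1.
rewrite eA.
have [ZA|ZA] := boolP ((Z2 == set0) && (Z1 == A)).
  case/andP: ZA c => /eqP-> /eqP->; rewrite enum_set0 => c.
  rewrite !eqxx !mulr1 -(@replace_monomE _ _ _ inc _ _ _ _ _ _ _ _ (minor M E A)) //.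
  by apply: unimodular_presentation_eslice prN _ c; rewrite ground_minor.
(* A nonzero coordinate would give a basis [B :|: A] of [M], which forces both exponents to
   vanish. *)
have -> : eslice N [set:: P] (enum A) = 0.
  apply/ffunP=> B; rewrite !ffunE; case: ifP => // sB.
  apply/eqP; apply: contraNT ZA => /plucker_neq0[_].
  have -> : [set:: enum B ++ enum A] = B :|: A.
    by apply/setP=> t; rewrite !inE mem_cat !mem_enum.
  by move=> /sN /(spanning _ sB)[-> ->]; rewrite !eqxx.
rewrite port_extensor0 scaler0 -mulrA -natrM mulnb (negPf ZA) mulr0.
by rewrite scale0r.
Qed.
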